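(* For $(\mathbb{F},\mathbb{A})\in\{(\mathbb{R},\mathbb{H}),(\mathbb{C},\mathbb{O})\}$, the geometry $\Gamma_\mathbb{F}(\mathbb{A})$ is either simply connected or covered by a building.
   Context: $\mathbb{H}$, $\mathbb{O}$ are the real quaternions and octonions, $\mathbb{C}\subset\mathbb{H}\subset\mathbb{O}$; $\mathbb{A},\mathbb{O}$ are right $\mathbb{F}$-vector spaces via right multiplication by $\mathbb{F}$. $(x|y)_\mathbb{R}=\mathrm{Re}(\bar xy)$; $(x|y)=(x|y)_\mathbb{R}$ if $\mathbb{F}=\mathbb{R}$, and for $\mathbb{F}=\mathbb{C}$, $(x|y)$ is the $\mathbb{C}$-component of $\bar xy$ in $\mathbb{O}=\mathbb{C}\oplus\mathbb{C}^{\perp}$. $\mathrm{Pu}_\mathbb{F}(\mathbb{B})$ is the real-orthogonal complement of $\mathbb{F}$ in $\mathbb{B}$. Sharp $\mathbb{F}$-morphisms $\mathbb{A}\to\mathbb{O}$: $\mathbb{F}$-linear multiplicative maps preserving $(\cdot|\cdot)$. $\Gamma_\mathbb{F}(\mathbb{A})$: points are 1-dim $\mathbb{F}$-subspaces $[x]$ of $\mathrm{Pu}_\mathbb{F}(\mathbb{A})$; lines are $[x,u]=\{(xt,ut):t\in\mathbb{F}^*\}$ with $x\in\mathrm{Pu}_\mathbb{F}(\mathbb{A})$, $u\in\mathrm{Pu}_\mathbb{F}(\mathbb{O})$, $|x|=|u|\ne0$; planes are sharp $\mathbb{F}$-morphisms $\phi:\mathbb{A}\to\mathbb{O}$; every point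 is incident with every plane, $[y]$ is incident with $[x,u]$ iff $(x|y)=0$, $[x,u]$ is incident with $\phi$ iff $\phi(x)=u$. It is a geometry of type $C_3$. A covering of rank-3 geometries is a type-preserving morphism inducing isomorphisms on rank-2 residues; a geometry is simply connected if it has no proper covering (equivalently its flag complex has trivial fundamental group), and is covered by a building if some building covers it. *)

(* Defs.v *)
From Stdlib Require Import Reals ZArith List Relations.
Open Scope R_scope.

Record alg := mkAlg {
  car : Type; zr : car; ad : car -> car -> car; ng : car -> car;
  ml : car -> car -> car; cj : car -> car }.

Definition cd (A : alg) : alg :=
  mkAlg (car A * car A)%type (zr A, zr A)
    (fun x y => (ad A (fst x) (fst y), ad A (snd x) (snd y)))
    (fun x => (ng A (fst x), ng A (snd x)))
    (fun x y => (ad A (ml A (fst x) (fst y)) (ng A (ml A (cj A (snd y)) (snd x))),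
                 ad A (ml A (snd y) (fst x)) (ml A (snd x) (cj A (fst y)))))
    (fun x => (cj A (fst x), ng A (snd x))).

Definition RA : alg := mkAlg R 0 Rplus Ropp Rmult (fun x => x).
Definition CA : alg := cd RA.
Definition HA : alg := cd CA.
Definition OA : alg := cd HA.
Definition Oct : Type := car OA.

Definition oadd (x y : Oct) : Oct := ad OA x y.
Definition omul (x y : Oct) : Oct := ml OA x y.
Definition oconj (x : Oct) : Oct := cj OA x.
Definition ozero : Oct := zr OA.

Definition re (x : Oct) : R := fst (fst (fst x)).
Definition ofR (r : R) : Oct := (((r, 0), (0, 0)), ((0, 0), (0, 0))).
Definition ofC (z : car CA) : Oct := ((z, zr CA), zr HA).
Definition isR (x : Oct) : Prop := exists r, x = ofR r.
Definition isC (x : Oct) : Prop := exists z : car CA, x = ofC z.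
Definition isH (x : Oct) : Prop := exists q : car HA, x = (q, zr HA).

Definition formR (x y : Oct) : R := re (omul (oconj x) y).
Definition onorm (x : Oct) : R := sqrt (formR x x).

Inductive FAcase := RH | CO.

Definition inF (c : FAcase) (x : Oct) : Prop :=
  match c with RH => isR x | CO => isC x end.
Definition inA (c : FAcase) (x : Oct) : Prop :=
  match c with RH => isH x | CO => True end.

Definition form (c : FAcase) (x y : Oct) : Oct :=
  match c with
  | RH => ofR (formR x y)
  | CO => ofC (fst (fst (omul (oconj x) y)))
  end.

Definition PuF (c : FAcase) (inB : Oct -> Prop) (x : Oct) : Prop :=
  inB x /\ forall f, inF c f -> formR f x = 0.

Definition pointset (c : FAcase) (x : Oct) : Oct -> Prop :=
  fun y => exists t, inF c t /\ y = omul x t.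
Definition lineset (c : FAcase) (x u : Oct) : Oct * Oct -> Prop :=
  fun p => exists t, inF c t /\ t <> ozero /\ p = (omul x t, omul u t).

Definition Gpoint (c : FAcase) : Type :=
  { P : Oct -> Prop | exists x, PuF c (inA c) x /\ x <> ozero /\ P = pointset c x }.
Definition Gline (c : FAcase) : Type :=
  { L : Oct * Oct -> Prop | exists x u, PuF c (inA c) x /\ PuF c (fun _ => True) u /\
      onorm x = onorm u /\ onorm x <> 0 /\ L = lineset c x u }.

(* sharp F-morphisms A -> O (as maps on O, normalised to 0 outside A) *)
Definition sharp (c : FAcase) (phi : Oct -> Oct) : Prop :=
  (forall x y, inA c x -> inA c y -> phi (oadd x y) = oadd (phi x) (phi y)) /\
  (forall x t, inA c x -> inF c t -> phi (omul x t) = omul (phi x) t) /\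
  (forall x y, inA c x -> inA c y -> phi (omul x y) = omul (phi x) (phi y)) /\
  (forall x y, inA c x -> inA c y -> form c (phi x) (phi y) = form c x y).
Definition Gplane (c : FAcase) : Type :=
  { phi : Oct -> Oct | sharp c phi /\ forall x, ~ inA c x -> phi x = ozero }.

(* types: P (points) -- L (lines) = Pl (planes), diagram C3 *)
Inductive typ3 := TP | TL | TPl.

Record geometry := mkGeom {
  elt : Type; typ : elt -> typ3; inc : elt -> elt -> Prop }.

Definition is_geometry (G : geometry) : Prop :=
  (forall a, inc G a a) /\ (forall a b, inc G a b -> inc G b a) /\
  (forall a b, inc G a b -> typ G a = typ G b -> a = b).

Definition connected (G : geometry) : Prop :=
  forall a b, clos_refl_trans (elt G) (inc G) a b.

Definition in_res (G : geometry) (a b : elt G) : Prop :=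
  inc G a b /\ typ G b <> typ G a.

Definition morphism (G' G : geometry) (f : elt G' -> elt G) : Prop :=
  (forall a, typ G (f a) = typ G' a) /\
  (forall a b, inc G' a b -> inc G (f a) (f b)).

Definition covering (G' G : geometry) (f : elt G' -> elt G) : Prop :=
  morphism G' G f /\ (forall y, exists x, f x = y) /\
  forall a,
    (forall b b', in_res G' a b -> in_res G' a b' -> f b = f b' -> b = b') /\
    (forall d, in_res G (f a) d -> exists b, in_res G' a b /\ f b = d) /\
    (forall b b', in_res G' a b -> in_res G' a b' -> inc G (f b) (f b') -> inc G' b b').

(* simply connected: every covering by a connected geometry is an isomorphism *)
Definition simply_connected (G : geometry) : Prop :=
  forall (G' : geometry) (f : elt G' -> elt G),
    is_geometry G' -> connected G' -> covering G' G f ->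
    forall a b, f a = f b -> a = b.

Definition Gelt (c : FAcase) : Type := (Gpoint c + (Gline c + Gplane c))%type.

Definition Gtyp (c : FAcase) (a : Gelt c) : typ3 :=
  match a with inl _ => TP | inr (inl _) => TL | inr (inr _) => TPl end.

Definition Grel (c : FAcase) (a b : Gelt c) : Prop :=
  match a, b with
  | inl P, inr (inl L) =>
      exists y x u, proj1_sig P = pointset c y /\ proj1_sig L = lineset c x u /\
                    form c x y = ozero
  | inl _, inr (inr _) => True
  | inr (inl L), inr (inr phi) =>
      exists x u, proj1_sig L = lineset c x u /\ proj1_sig phi x = u
  | _, _ => False
  end.

Definition Ginc (c : FAcase) (a b : Gelt c) : Prop :=
  a = b \/ Grel c a b \/ Grel c b a.

Definition Gamma (c : FAcase) : geometry := mkGeom (Gelt c) (Gtyp c) (Ginc c).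

(* The Coxeter group W of type C3 = B3 (signed permutations of {1,2,3}) *)
(* generators: s1 = (1 2), s2 = (2 3), s3 = sign change of e3;
   m(s1,s2) = 3, m(s2,s3) = 4, m(s1,s3) = 2.
   w is encoded by (w e1, w e2, w e3), each w e_i = +- e_k encoded by +-k. *)
Inductive gen := s1 | s2 | s3.
Definition W : Type := (Z * Z * Z)%type.
Definition W1 : W := (1%Z, 2%Z, 3%Z).

Definition gact_Z (s : gen) (z : Z) : Z :=
  match s with
  | s1 => match z with 1%Z => 2%Z | 2%Z => 1%Z | (-1)%Z => (-2)%Z | (-2)%Z => (-1)%Z | _ => z end
  | s2 => match z with 2%Z => 3%Z | 3%Z => 2%Z | (-2)%Z => (-3)%Z | (-3)%Z => (-2)%Z | _ => z end
  | s3 => match z with 3%Z => (-3)%Z | (-3)%Z => 3%Z | _ => z end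
  end.

Definition smul (s : gen) (w : W) : W :=
  match w with (a, b, c) => (gact_Z s a, gact_Z s b, gact_Z s c) end.
Definition gelt (s : gen) : W := smul s W1.
Definition wprod (l : list gen) : W := fold_right smul W1 l.
Definition inW (w : W) : Prop := exists l, wprod l = w.

Definition coxlen (w : W) (n : nat) : Prop :=
  (exists l, length l = n /\ wprod l = w) /\
  (forall l, wprod l = w -> (n <= length l)%nat).

(* Buildings of type C3 (W-metric definition, Abramenko--Brown 5.1)    *)
Record building := mkBuilding {
  chamber : Type;
  delta : chamber -> chamber -> W;
  delta_W : forall C D, inW (delta C D);
  WD1 : forall C D, delta C D = W1 <-> C = D;
  WD2 : forall C D C' (s : gen) n, delta C' C = gelt s ->
          (delta C' D = smul s (delta C D) \/ delta C' D = delta C D) /\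
          (coxlen (delta C D) n -> coxlen (smul s (delta C D)) (S n) ->
             delta C' D = smul s (delta C D));
  WD3 : forall C D (s : gen), exists C',
          delta C' C = gelt s /\ delta C' D = smul s (delta C D) }.

Definition gen_of (t : typ3) : gen :=
  match t with TP => s1 | TL => s2 | TPl => s3 end.

Definition in_cotype_parabolic (t : typ3) (w : W) : Prop :=
  exists l, Forall (fun s => s <> gen_of t) l /\ wprod l = w.

(* elements of type t: residues of type S \ {gen_of t}, as sets of chambers;
   incidence: nonempty intersection *)
Definition Belt (B : building) : Type :=
  { p : typ3 * (chamber B -> Prop) |
      exists C, forall D, snd p D <-> in_cotype_parabolic (fst p) (delta B C D) }.

Definition bgeom (B : building) : geometry :=
  mkGeom (Belt B) (fun a => fst (proj1_sig a))
         (fun a b => exists C, snd (proj1_sig a) C /\ snd (proj1_sig b) C).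

Definition covered_by_building (G : geometry) : Prop :=
  exists (B : building) (f : elt (bgeom B) -> elt G), covering (bgeom B) G f.

(* Main.v *)
Require Import Defs.
From Stdlib Require Import Reals ZArith List Relations Lra.
From Stdlib Require Import Classical ClassicalEpsilon FunctionalExtensionality PropExtensionality ProofIrrelevance.

(** Gamma is simply connected in both cases. Every point is incident with every plane, so in a
    covering G' each lift of a point [p] sees exactly one lift of each plane. Planes are the
    restrictions of elements of G = Aut_F(O), so G acts, for every [p], on the lifted planes
    (paired with an inducing automorphism): s_p(g) follows g inside the residue of the lift of [p].
    If g fixes x and x is orthogonal to p and q, then s_p(g) = s_q(g), because both move along
    the same lifted line. One has to show that s_p does not depend on p; then all lifted planes
    have the same points, and G' -> Gamma is injective.

    Choose a quaternion subalgebra H = <1,i,j,k> and l orthogonal to H, with real points i, j, k.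
    Let t_x(g) be s_q(g) for g fixing x and any q orthogonal to x. Let h be the automorphism
    i -> il, j -> -jl fixing k and l, and A a rotation about k. The defect t_k(h) s_k(h)^-1
    commutes with s_k of all rotations about i and about j, hence with s_k(A), whereas
    conjugation by s_k(A) replaces h by A h A^-1. As h^-1 A^-1 h = A, this gives
    t_k(A^2) = s_k(A^2). Rotating a point orthogonal to i in the plane <i,j> to an arbitrary
    point x of this plane by A^2, one obtains t_x(g) = s_i(g) for every g fixing x. Any two
    points are in this position after an octonion automorphism, and G is generated by the
    stabilizers of points. *)

(** * Octonion arithmetic *)

Definition scal (r : R) (x : Oct) : Oct := omul x (ofR r).
Definition oneg (x : Oct) : Oct := ng OA x.
Arguments oadd : simpl never.
Arguments omul : simpl never.
Arguments oconj : simpl never.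
Arguments ofR : simpl never.
Arguments ofC : simpl never.
Arguments oneg : simpl never.
Arguments formR : simpl never.
Arguments scal : simpl never.
Definition one : Oct := ofR 1.
Definition embH (q : car HA) : Oct := (q, zr HA).
Definition oi : Oct := ofC (0, 1).
Definition oj : Oct := embH ((0, 0), (1, 0)).
Definition ok : Oct := embH ((0, 0), (0, 1)).
Definition ol : Oct := (zr HA, ((1, 0), (0, 0))).

Lemma oct_eta (x : Oct) : exists a b c d e f g h : R, x = (((a,b),(c,d)),((e,f),(g,h))).
Proof. destruct x as [[[a b] [c d]] [[e f] [g h]]]; repeat eexists. Qed.
Lemma quat_eta (x : car HA) : exists a b c d : R, x = ((a,b),(c,d)).
Proof. destruct x as [[a b] [c d]]; repeat eexists. Qed.
Lemma cplx_eta (x : car CA) : exists a b : R, x = (a,b).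
Proof. destruct x as [a b]; repeat eexists. Qed.
Lemma oct_eq (a b c d e f g h a' b' c' d' e' f' g' h' : R) :
  a = a' -> b = b' -> c = c' -> d = d' -> e = e' -> f = f' -> g = g' -> h = h' ->
  (((a,b),(c,d)),((e,f),(g,h))) = (((a',b'),(c',d')),((e',f'),(g',h'))) :> Oct.
Proof. now intros -> -> -> -> -> -> -> ->. Qed.

Ltac odestr :=
  repeat match goal with
  | x : Oct |- _ => destruct (oct_eta x) as (? & ? & ? & ? & ? & ? & ? & ? & ->)
  | x : car OA |- _ => destruct (oct_eta x) as (? & ? & ? & ? & ? & ? & ? & ? & ->)
  | x : car HA |- _ => destruct (quat_eta x) as (? & ? & ? & ? & ->)
  | x : car CA |- _ => destruct (cplx_eta x) as (? & ? & ->)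
  end.
Ltac ounf :=
  unfold formR, scal, oneg, one, oi, oj, ok, ol, embH, re, oadd, omul, oconj, ozero, ofR, ofC in *;
  cbn [fst snd OA HA CA RA cd car zr ad ng ml cj] in *.
Ltac oct := intros; odestr; ounf; try apply oct_eq; ring.

Lemma mul1o x : omul one x = x. Proof. oct. Qed.
Lemma mulo1 x : omul x one = x. Proof. oct. Qed.
Lemma mulDl x y z : omul (oadd x y) z = oadd (omul x z) (omul y z). Proof. oct. Qed.
Lemma mulDr x y z : omul x (oadd y z) = oadd (omul x y) (omul x z). Proof. oct. Qed.
Lemma mulNl x y : omul (oneg x) y = oneg (omul x y). Proof. oct. Qed.
Lemma mulNr x y : omul x (oneg y) = oneg (omul x y). Proof. oct. Qed.
Lemma negK x : oneg (oneg x) = x. Proof. oct. Qed.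
Lemma conjM x y : oconj (omul x y) = omul (oconj y) (oconj x). Proof. oct. Qed.
Lemma conjD x y : oconj (oadd x y) = oadd (oconj x) (oconj y). Proof. oct. Qed.
Lemma conjK x : oconj (oconj x) = x. Proof. oct. Qed.
Lemma conjE x : oconj x = oadd (scal (2 * formR one x) one) (oneg x). Proof. oct. Qed.
Lemma formC x y : formR x y = formR y x. Proof. oct. Qed.
Lemma formDr x y z : formR x (oadd y z) = formR x y + formR x z. Proof. oct. Qed.
Lemma formDl x y z : formR (oadd y z) x = formR y x + formR z x. Proof. oct. Qed.
Lemma formZr r x y : formR x (scal r y) = r * formR x y. Proof. oct. Qed.
Lemma formZl r x y : formR (scal r x) y = r * formR x y. Proof. oct. Qed.
Lemma formNr x y : formR x (oneg y) = - formR x y. Proof. oct. Qed.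
Lemma formNl x y : formR (oneg x) y = - formR x y. Proof. oct. Qed.
Lemma form_mull x y z : formR (omul x y) z = formR y (omul (oconj x) z). Proof. oct. Qed.
Lemma form_mulr x y z : formR (omul x y) z = formR x (omul z (oconj y)). Proof. oct. Qed.
(** This polarises the alternative law x(x̄z) = |x|²z and does the work of associativity in the
    product rules below. *)
Lemma linearized_norm x y z :
  oadd (omul x (omul (oconj y) z)) (omul y (omul (oconj x) z)) = scal (2 * formR x y) z.
Proof. oct. Qed.
Lemma norm_mul x y : formR (omul x y) (omul x y) = formR x x * formR y y.
Proof. oct. Qed.

(** * The Cayley-Dickson extension of a homomorphism *)

Lemma add_eq0 x y : oadd x y = ozero -> y = oneg x.
Proof.
  intros H. transitivity (oadd (oadd x y) (oneg x)); [oct|]. rewrite H. oct.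
Qed.
Lemma scal0 z : scal 0 z = ozero. Proof. oct. Qed.
Lemma conjN u : formR one u = 0 -> oconj u = oneg u.
Proof. intros H. rewrite conjE, H. oct. Qed.

(** * Product rules for an imaginary unit u and factors orthogonal to it *)

Section ImaginaryUnit.
Variable u : Oct.
Hypothesis u1 : formR one u = 0.
Hypothesis uu : formR u u = 1.

Lemma mul_orth d : formR d u = 0 -> omul d u = omul u (oconj d).
Proof.
  intros H. generalize (linearized_norm d u one). rewrite H, Rmult_0_r, scal0, !mulo1, (conjN u u1), mulNr.
  intros E. apply add_eq0 in E. now rewrite negK in E.
Qed.
Lemma mul_unit_unit y : omul u (omul u y) = oneg y.
Proof.
  generalize (linearized_norm u u y). rewrite (conjN u u1), uu, !mulNl, !mulNr.
  generalize (omul u (omul u y)). intros z E.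
  transitivity (scal (-/2) (oadd (oneg z) (oneg z))).
  - odestr; ounf; apply oct_eq; field.
  - rewrite E. odestr; ounf; apply oct_eq; field.
Qed.
(** Write du = u d̄ and apply the linearized norm to a, u and d̄: a(u d̄) = u(ā d̄), and ā d̄ is the
    conjugate of da. *)
Lemma mul_orth_l a d : formR a u = 0 -> formR d u = 0 -> formR (omul d a) u = 0 ->
  omul a (omul d u) = omul (omul d a) u.
Proof.
  intros Ha Hd Hda. rewrite (mul_orth d Hd), (mul_orth _ Hda), conjM.
  generalize (linearized_norm a u (oconj d)).
  rewrite Ha, Rmult_0_r, scal0, (conjN u u1), mulNl, mulNr.
  intros E. apply add_eq0 in E. rewrite negK in E. easy.
Qed.
Lemma conj_orth b : formR b u = 0 -> oconj (omul b u) = oneg (omul b u).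
Proof. intros Hb. now rewrite conjM, (conjN u u1), mulNl, <- mul_orth. Qed.
(** Conjugation turns this into the previous rule, since bu is imaginary. *)
Lemma mul_orth_r b c : formR b u = 0 -> formR (oconj c) u = 0 ->
  formR (omul b (oconj c)) u = 0 ->
  omul (omul b u) c = omul (omul b (oconj c)) u.
Proof.
  intros Hb Hc Hbc. rewrite <- (conjK (omul (omul b u) c)), conjM, (conj_orth b Hb), mulNr.
  now rewrite mul_orth_l, <- (conj_orth _ Hbc), conjK.
Qed.
(** The linearized norm is applied to bu, u and d̄. The inner product of bu and u is the real part
    of b, which cancels against b̄ = 2 Re b - b. *)
Lemma mul_orth_lr b d : formR b u = 0 -> formR (oconj d) u = 0 -> formR d u = 0 ->
  formR (omul b d) u = 0 -> formR (oconj (omul b d)) u = 0 ->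
  omul (omul b u) (omul d u) = oneg (omul (oconj d) b).
Proof.
  intros Hb Hd' Hd Hbd Hbd'. rewrite (mul_orth d Hd).
  generalize (linearized_norm (omul b u) u (oconj d)).
  rewrite conjM, (conjN u u1), !mulNl, !mulNr.
  rewrite <- (mul_orth b Hb).
  rewrite (mul_orth_r b (oconj d)); rewrite ?conjK; try easy.
  rewrite (mul_orth _ Hbd), mul_unit_unit, negK, conjM.
  replace (formR (omul b u) u) with (formR one b)
    by (rewrite form_mulr, (conjN u u1), mulNr, formC; replace (omul u u) with (oneg one);
        [now rewrite negK | now rewrite <- (mulo1 u) at 2; rewrite mul_unit_unit ]).
  rewrite (conjE b), mulDr, mulNr.
  generalize (omul (omul b u) (omul u (oconj d))). intros z E.
  (* The same term is added and subtracted, so that the left side of [E] appears and can be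
     rewritten. *)
  replace z with (oneg (oadd (oadd (oneg z) (oadd (omul (oconj d) (scal (2 * formR one b) one))
    (oneg (omul (oconj d) b)))) (oneg (oadd (omul (oconj d) (scal (2 * formR one b) one))
    (oneg (omul (oconj d) b))))));
   [rewrite E|]; generalize (omul (oconj d) b) (formR one b); oct.
Qed.
End ImaginaryUnit.

Definition hom (A : alg) (phi : car A -> Oct) : Prop :=
  (forall x y, phi (ad A x y) = oadd (phi x) (phi y)) /\
  (forall x, phi (ng A x) = oneg (phi x)) /\
  (forall x y, phi (ml A x y) = omul (phi x) (phi y)) /\
  (forall x, phi (cj A x) = oconj (phi x)).

Definition dbl (A : alg) (phi : car A -> Oct) (u : Oct) : car (cd A) -> Oct :=
  fun p => oadd (phi (fst p)) (omul (phi (snd p)) u).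

(** The three product rules match the three cross terms of the doubling formula. Their orthogonality
    conditions all follow from the last hypothesis, because the image of [phi] is closed under
    products and conjugation. *)
Lemma hom_dbl (A : alg) phi u : hom A phi -> formR one u = 0 -> formR u u = 1 ->
  (forall a, formR (phi a) u = 0) -> hom (cd A) (dbl A phi u).
Proof.
  intros (Hd & Hn & Hm & Hc) H1 Huu Hu. unfold dbl. repeat split; cbn.
  - intros. rewrite !Hd, mulDl. generalize (omul (phi (snd x)) u) (omul (phi (snd y)) u). 
    generalize (phi (fst x)) (phi (fst y)). oct.
  - intros. rewrite !Hn, mulNl. generalize (omul (phi (snd x)) u) (phi (fst x)). oct.
  - intros [a b] [c d]; cbn. rewrite !mulDl, !mulDr.
    rewrite (mul_orth_l u), (mul_orth_r u), (mul_orth_lr u); trivial; rewrite <- ?Hc, <- ?Hm, <- ?Hc; try apply Hu.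
    rewrite !Hd, !Hn, mulDl.
    generalize (phi (ml A a c)) (phi (ml A (cj A d) b)) (omul (phi (ml A d a)) u) (omul (phi (ml A b (cj A c))) u).
    oct.
  - intros [a b]; cbn. rewrite conjD, conjM, Hc, Hn, (conjN u), mulNl, mulNl, <- mul_orth; trivial.
Qed.

Lemma hom_ofR : hom RA ofR.
Proof. repeat split; intros; ounf; apply oct_eq; ring. Qed.

(** Three doublings starting from the reals; i, j, l go to u1, u2, u3. *)
Definition ext (u1 u2 u3 : Oct) : Oct -> Oct := dbl HA (dbl CA (dbl RA ofR u1) u2) u3.

(** The basic triples of the octonions, that is, the possible images of i, j, l under an
    automorphism. *)
Definition triple (u1 u2 u3 : Oct) : Prop :=
  (formR one u1 = 0 /\ formR one u2 = 0 /\ formR one u3 = 0) /\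
  (formR u1 u1 = 1 /\ formR u2 u2 = 1 /\ formR u3 u3 = 1) /\
  formR u1 u2 = 0 /\ formR u1 u3 = 0 /\ formR u2 u3 = 0 /\ formR (omul u1 u2) u3 = 0.

Lemma form_ofR r u : formR (ofR r) u = r * formR one u. Proof. oct. Qed.
Lemma mul_ofR r u : omul (ofR r) u = scal r u. Proof. oct. Qed.
Lemma mul_scal r u v : omul (scal r u) v = scal r (omul u v). Proof. oct. Qed.

Lemma hom_ext2 u1 u2 : formR one u1 = 0 -> formR one u2 = 0 -> formR u1 u1 = 1 -> formR u2 u2 = 1 ->
  formR u1 u2 = 0 -> hom HA (dbl CA (dbl RA ofR u1) u2).
Proof.
  intros a b d e g.
  apply hom_dbl; trivial. apply hom_dbl; trivial. 
  - apply hom_ofR.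
  - intros r. rewrite form_ofR, a. ring.
  - intros [r s]; unfold dbl; cbn. rewrite formDl, form_ofR, mul_ofR, formZl, b, g. ring.
Qed.

(** * Isometries and automorphisms of the octonions *)

(** Sum over the standard orthonormal basis. Dimension arguments are carried out as comparisons of
    such traces. *)
Definition tr (g : Oct -> R) : R :=
  g (((1,0),(0,0)),((0,0),(0,0))) + g (((0,1),(0,0)),((0,0),(0,0))) +
  g (((0,0),(1,0)),((0,0),(0,0))) + g (((0,0),(0,1)),((0,0),(0,0))) +
  g (((0,0),(0,0)),((1,0),(0,0))) + g (((0,0),(0,0)),((0,1),(0,0))) +
  g (((0,0),(0,0)),((0,0),(1,0))) + g (((0,0),(0,0)),((0,0),(0,1))).

Lemma tr_form y : tr (fun b => formR y b * formR y b) = formR y y.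
Proof. unfold tr. oct. Qed.
Lemma tr_one : tr (fun b => formR b b) = 8.
Proof. unfold tr. ounf. ring. Qed.
Lemma tr_ext f g : (forall x, f x = g x) -> tr f = tr g.
Proof. intros H. unfold tr. now rewrite !H. Qed.
Lemma tr_add f g : tr (fun b => f b + g b) = tr f + tr g.
Proof. unfold tr. ring. Qed.
Lemma tr_zero f : (forall x, 0 <= f x) -> tr f = 0 ->
  forall g, (forall x, f x = 0 -> g x = 0) -> tr (fun b => g b * g b) = 0.
Proof.
  unfold tr. intros H E g Hg.
  repeat match goal with |- context [g ?b * g ?b] =>
    rewrite (Hg b) by (generalize (H (((1,0),(0,0)),((0,0),(0,0)))) (H (((0,1),(0,0)),((0,0),(0,0))))
  (H (((0,0),(1,0)),((0,0),(0,0)))) (H (((0,0),(0,1)),((0,0),(0,0))))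
  (H (((0,0),(0,0)),((1,0),(0,0)))) (H (((0,0),(0,0)),((0,1),(0,0))))
  (H (((0,0),(0,0)),((0,0),(1,0)))) (H (((0,0),(0,0)),((0,0),(0,1)))); lra) end.
  ring.
Qed.

Lemma form_ge0 x : 0 <= formR x x.
Proof. odestr. ounf. nra. Qed.
Lemma form_eq0 x : formR x x = 0 -> x = ozero.
Proof.
  odestr. ounf. intros H. apply oct_eq; nra.
Qed.
Lemma sub_eq0 x y : oadd x (oneg y) = ozero -> x = y.
Proof. intros H. apply add_eq0 in H. rewrite <- (negK x), <- H. apply negK. Qed.
Lemma form_inj x y : (forall z, formR z x = formR z y) -> x = y.
Proof.
  intros H. apply sub_eq0, form_eq0. rewrite formDr, formNr, H. ring.
Qed.

Definition linear (f : Oct -> Oct) : Prop :=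
  (forall x y, f (oadd x y) = oadd (f x) (f y)) /\ (forall r x, f (scal r x) = scal r (f x)).
Definition isometry (f : Oct -> Oct) : Prop := forall x y, formR (f x) (f y) = formR x y.

(** The transpose in coordinates; for an isometry it provides the inverse explicitly. *)
Definition adjoint (f : Oct -> Oct) (y : Oct) : Oct :=
  let g := fun z => formR (f z) y in
  (((g (((1,0),(0,0)),((0,0),(0,0))), g (((0,1),(0,0)),((0,0),(0,0)))),
    (g (((0,0),(1,0)),((0,0),(0,0))), g (((0,0),(0,1)),((0,0),(0,0))))),
   ((g (((0,0),(0,0)),((1,0),(0,0))), g (((0,0),(0,0)),((0,1),(0,0)))),
    (g (((0,0),(0,0)),((0,0),(1,0))), g (((0,0),(0,0)),((0,0),(0,1)))))).

Lemma adjointP f y z : linear f -> formR (adjoint f y) z = formR y (f z).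
Proof.
  intros [Hd Hz].
  transitivity (tr (fun b => formR z b * formR (f b) y)).
  - unfold tr, adjoint. generalize (fun z => formR (f z) y). intros g. 
    destruct (oct_eta z) as (? & ? & ? & ? & ? & ? & ? & ? & ->). cbv beta zeta.
    ounf. ring.
  - rewrite (formC y).
    (* z is expanded in the standard basis, so that linearity of [f] applies. *)
    transitivity (formR (f (oadd (oadd (oadd (scal (formR z (((1,0),(0,0)),((0,0),(0,0)))) (((1,0),(0,0)),((0,0),(0,0)))) 
      (scal (formR z (((0,1),(0,0)),((0,0),(0,0)))) (((0,1),(0,0)),((0,0),(0,0)))))
     (oadd (scal (formR z (((0,0),(1,0)),((0,0),(0,0)))) (((0,0),(1,0)),((0,0),(0,0)))) 
      (scal (formR z (((0,0),(0,1)),((0,0),(0,0)))) (((0,0),(0,1)),((0,0),(0,0))))))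
     (oadd (oadd (scal (formR z (((0,0),(0,0)),((1,0),(0,0)))) (((0,0),(0,0)),((1,0),(0,0)))) 
      (scal (formR z (((0,0),(0,0)),((0,1),(0,0)))) (((0,0),(0,0)),((0,1),(0,0)))))
     (oadd (scal (formR z (((0,0),(0,0)),((0,0),(1,0)))) (((0,0),(0,0)),((0,0),(1,0)))) 
      (scal (formR z (((0,0),(0,0)),((0,0),(0,1)))) (((0,0),(0,0)),((0,0),(0,1)))))))) y).
    + rewrite !Hd, !Hz, !formDl, !formZl. unfold tr. ring.
    + f_equal. f_equal. oct.
Qed.

(* Parseval: the eight images of the basis have total squared length 8, which leaves
   no room for a vector outside the image. *)
Lemma adjointK f : linear f -> isometry f -> forall y, f (adjoint f y) = y.
Proof.
  intros Hl Hi.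
  pose (r := fun y => oadd y (oneg (f (adjoint f y)))).
  assert (Hr : forall y, formR (r y) (r y) = formR y y - formR (adjoint f y) (adjoint f y)).
  { intros y. unfold r. rewrite !formDl, !formDr, !formNl, !formNr, Hi.
    rewrite (formC (f _) y), <- adjointP by trivial. ring. }
  assert (Ht : tr (fun b => formR (r b) (r b)) = 0).
  { rewrite (tr_ext _ _ Hr). 
    assert (E : tr (fun b => formR (adjoint f b) (adjoint f b)) = 8).
    { rewrite <- tr_one.
      transitivity (tr (fun b => formR (f b) (f b))).
      - transitivity (tr (fun b => tr (fun d => formR (f d) b * formR (f d) b))).
        + apply tr_ext. intros b. rewrite <- tr_form. apply tr_ext. intros d.
          now rewrite adjointP, (formC b).
        + transitivity (tr (fun d => tr (fun b => formR (f d) b * formR (f d) b))).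
          * unfold tr. ring.
          * apply tr_ext. intros. apply tr_form.
      - apply tr_ext. intros. apply Hi. }
    transitivity (tr (fun b => formR b b) - tr (fun b => formR (adjoint f b) (adjoint f b))).
    - unfold tr. ring.
    - rewrite E, tr_one. ring. }
  assert (Horth : forall y z, formR (r y) (f z) = 0).
  { intros y z. unfold r. rewrite formDl, formNl, Hi, adjointP by trivial. ring. }
  intros y. symmetry. apply sub_eq0. change (r y = ozero). apply form_eq0. rewrite <- tr_form.
  apply (tr_zero (fun b => formR (r b) (r b))); trivial.
  - intros; apply form_ge0.
  - intros b Hb. apply form_eq0, sub_eq0 in Hb. rewrite Hb. apply Horth.
Qed.

(** Zero is allowed so that one statement about four vectors also covers shorter orthonormal
    systems. *)
Definition unit_or_zero (v : Oct) : Prop := formR v v = 1 \/ v = ozero.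

Lemma form0r x : formR x ozero = 0. Proof. oct. Qed.
Lemma form0l x : formR ozero x = 0. Proof. oct. Qed.

Lemma unit_scal x : x <> ozero -> exists r, r * r * formR x x = 1 /\ 0 < r.
Proof.
  intros H. assert (Hp : 0 < formR x x).
  { destruct (form_ge0 x) as [E|E]; trivial. now destruct H; apply form_eq0. }
  pose proof (sqrt_lt_R0 _ Hp) as Hs. pose proof (sqrt_sqrt (formR x x) (Rlt_le _ _ Hp)) as E.
  exists (/ sqrt (formR x x)). repeat split.
  - rewrite <- E at 3. field. lra.
  - now apply Rinv_0_lt_compat.
Qed.

(** If the residue [r] of the orthogonal projection vanished identically, the squared norm, of trace
    8, would be a sum of four squares of linear forms, each of trace at most 1. *)
Lemma exists_orth v1 v2 v3 v4 :
  unit_or_zero v1 -> unit_or_zero v2 -> unit_or_zero v3 -> unit_or_zero v4 ->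
  formR v1 v2 = 0 -> formR v1 v3 = 0 -> formR v1 v4 = 0 ->
  formR v2 v3 = 0 -> formR v2 v4 = 0 -> formR v3 v4 = 0 ->
  exists b, formR b b = 1 /\ formR v1 b = 0 /\ formR v2 b = 0 /\ formR v3 b = 0 /\ formR v4 b = 0.
Proof.
  intros U1 U2 U3 U4 H12 H13 H14 H23 H24 H34.
  pose (r := fun b => oadd b (oneg (oadd (oadd (scal (formR v1 b) v1) (scal (formR v2 b) v2))
                       (oadd (scal (formR v3 b) v3) (scal (formR v4 b) v4))))).
  assert (Hu : forall v x, unit_or_zero v -> formR v x - formR v x * formR v v = 0).
  { intros v x [E|E]; rewrite E, ?form0l; ring. }
  assert (Ho : forall b, formR v1 (r b) = 0 /\ formR v2 (r b) = 0 /\ formR v3 (r b) = 0 /\ formR v4 (r b) = 0).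
  { intros b. unfold r. rewrite !formDr, !formNr, !formDr, !formZr.
    rewrite (formC v2 v1), (formC v3 v1), (formC v4 v1), (formC v3 v2), (formC v4 v2), (formC v4 v3).
    rewrite H12, H13, H14, H23, H24, H34.
    pose proof (Hu v1 b U1). pose proof (Hu v2 b U2). pose proof (Hu v3 b U3). pose proof (Hu v4 b U4).
    repeat split; lra. }
  destruct (classic (exists b, r b <> ozero)) as [[b Hb]|Hn].
  - destruct (unit_scal _ Hb) as (s & Hs & _). exists (scal s (r b)).
    rewrite !formZr, formZl. destruct (Ho b) as (-> & -> & -> & ->). repeat split; try ring.
    lra.
  - exfalso.
    assert (E : forall b, formR b b = formR v1 b * formR v1 b + formR v2 b * formR v2 b
        + (formR v3 b * formR v3 b + formR v4 b * formR v4 b)).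
    { intros b. assert (r b = ozero) as Hb by (apply NNPP; intros ?; apply Hn; now exists b).
      unfold r in Hb. apply sub_eq0 in Hb. rewrite Hb at 1. rewrite !formDl, !formZl. ring. }
    pose proof (tr_ext _ _ E) as T. rewrite !tr_add, !tr_form, tr_one in T.
    assert (L : forall v, unit_or_zero v -> formR v v <= 1) by (intros v [->| ->]; rewrite ?form0l; lra).
    pose proof (L _ U1). pose proof (L _ U2). pose proof (L _ U3). pose proof (L _ U4). lra.
Qed.

(** The inverse is carried as data. As it is determined by [af], two automorphisms with the same
    [af] are equal. *)
Record aut := mkAut {
  af : Oct -> Oct; ab : Oct -> Oct;
  af_add : forall x y, af (oadd x y) = oadd (af x) (af y);
  af_mul : forall x y, af (omul x y) = omul (af x) (af y);
  af_R : forall r, af (ofR r) = ofR r;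
  af_form : forall x y, formR (af x) (af y) = formR x y;
  afK : forall x, ab (af x) = x;
  abK : forall x, af (ab x) = x }.

(** The inverse is the adjoint: injectivity of the isometry is immediate, surjectivity is
    [adjointK]. *)
Lemma aut_of (f : Oct -> Oct) :
  (forall x y, f (oadd x y) = oadd (f x) (f y)) ->
  (forall x y, f (omul x y) = omul (f x) (f y)) ->
  (forall r, f (ofR r) = ofR r) -> isometry f -> exists g, forall x, af g x = f x.
Proof.
  intros Ha Hm Hr Hi.
  assert (Hl : linear f) by (split; trivial; intros r x; unfold scal; now rewrite Hm, Hr).
  unshelve eexists (mkAut f (adjoint f) Ha Hm Hr Hi _ _); trivial.
  - intros x. apply form_inj. intros z. now rewrite formC, adjointP, formC.
  - now apply adjointK.
Qed.

Lemma aut_eq g h : (forall x, af g x = af h x) -> g = h.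
Proof.
  intros H. destruct g as [f b a1 a2 a3 a4 a5 a6], h as [f' b' a1' a2' a3' a4' a5' a6']; cbn in H.
  assert (f = f') as <- by now apply functional_extensionality.
  assert (b = b') as <-.
  { apply functional_extensionality. intros x. rewrite <- (a6' x) at 1. apply a5. }
  f_equal; apply proof_irrelevance.
Qed.

Definition acomp (g h : aut) : aut.
Proof.
  refine (mkAut (fun x => af g (af h x)) (fun x => ab h (ab g x)) _ _ _ _ _ _).
  - intros; now rewrite !af_add.
  - intros; now rewrite !af_mul.
  - intros; now rewrite !af_R.
  - intros x y; cbv beta; now rewrite !af_form.
  - intros; now rewrite !afK.
  - intros; now rewrite !abK.
Defined.
Definition ainv (g : aut) : aut.
Proof.
  refine (mkAut (ab g) (af g) _ _ _ _ _ _).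
  - intros. rewrite <- (abK g x), <- (abK g y) at 1. now rewrite <- af_add, afK.
  - intros. rewrite <- (abK g x), <- (abK g y) at 1. now rewrite <- af_mul, afK.
  - intros. rewrite <- (af_R g r) at 1. apply afK.
  - intros x y. now rewrite <- (af_form g), !abK.
  - apply abK.
  - apply afK.
Defined.
Definition aid : aut.
Proof. refine (mkAut (fun x => x) (fun x => x) _ _ _ _ _ _); easy. Defined.

Lemma af_scal g r x : af g (scal r x) = scal r (af g x).
Proof. unfold scal. now rewrite af_mul, af_R. Qed.
Lemma af_neg g x : af g (oneg x) = oneg (af g x).
Proof. replace (oneg x) with (scal (-1) x) by oct. rewrite af_scal. generalize (af g x). oct. Qed.

Lemma mul0o x : omul ozero x = ozero. Proof. oct. Qed.
Lemma add0o x : oadd ozero x = x. Proof. oct. Qed.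
Lemma addo0 x : oadd x ozero = x. Proof. oct. Qed.
Lemma re_mul a b : formR one a = 0 -> formR one (omul a b) = - formR a b.
Proof. intros H. now rewrite formC, form_mull, mulo1, (conjN a H), formNr, formC. Qed.
Lemma form_re x y : formR x y = formR one (omul (oconj x) y). Proof. oct. Qed.

(** Multiplicativity comes from the doublings. Real parts are preserved because u1, u2, u3 and their
    products are imaginary; hence so is the form, the real part of x̄y. *)
Lemma ext_aut u1 u2 u3 : triple u1 u2 u3 -> exists g, forall x, af g x = ext u1 u2 u3 x.
Proof.
  intros ((a1 & a2 & a3) & (b1 & b2 & b3) & c12 & c13 & c23 & c).
  assert (Him : forall p, formR (dbl CA (dbl RA ofR u1) u2 p) u3 = 0).
  { intros [[r s] [t w]]. unfold dbl; cbn.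
    rewrite !mulDl, !formDl, !mul_ofR, mul_scal, !formZl, form_ofR, a3, c13, c23, c. ring. }
  destruct (hom_dbl HA (dbl CA (dbl RA ofR u1) u2) u3) as (Ha & _ & Hm & Hc); trivial.
  { now apply hom_ext2. }
  change (cd HA) with OA in *. change (dbl HA (dbl CA (dbl RA ofR u1) u2) u3) with (ext u1 u2 u3) in *.
  assert (Hr : forall r, ext u1 u2 u3 (ofR r) = ofR r).
  { intros r. unfold ext, dbl; cbn. change (ofR 0) with ozero. now repeat (rewrite mul0o || rewrite addo0). }
  assert (Hre : forall x, formR one (ext u1 u2 u3 x) = formR one x).
  { intros x. destruct (oct_eta x) as (x0 & x1 & x2 & x3 & x4 & x5 & x6 & x7 & ->).
    transitivity (formR one (ofR x0)); [| oct].
    unfold ext, dbl; cbn. rewrite !mulDl, !formDr, !mul_ofR, !mul_scal, !formZr, a1, a2, a3.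
    assert (E : formR one (omul u1 u2) = 0 /\ formR one (omul u1 u3) = 0 /\ formR one (omul u2 u3) = 0 /\
                formR one (omul (omul u1 u2) u3) = 0).
    { rewrite !re_mul, c12, c13, c23, c; trivial; [lra|]. rewrite re_mul, c12; trivial; ring. }
    destruct E as (-> & -> & -> & ->). oct. }
  apply aut_of; trivial.
  intros x y. rewrite (form_re x), <- Hre, form_re. unfold omul, oconj. now rewrite Hm, Hc.
Qed.

Lemma ext_H u1 u2 u3 q : ext u1 u2 u3 (embH q) = dbl CA (dbl RA ofR u1) u2 q.
Proof.
  unfold ext, embH. unfold dbl at 1; cbn. unfold dbl; cbn. change (ofR 0) with ozero.
  now repeat (rewrite mul0o || rewrite addo0).
Qed.
Ltac ext_eval := unfold ext, dbl, oi, oj, ol, ofC, embH; cbn;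
  change (ofR 0) with ozero; change (ofR 1) with one;
  now repeat (rewrite mul0o || rewrite addo0 || rewrite mul1o || rewrite add0o).
Lemma ext_i u1 u2 u3 : ext u1 u2 u3 oi = u1.
Proof. ext_eval. Qed.
Lemma ext_j u1 u2 u3 : ext u1 u2 u3 oj = u2.
Proof. ext_eval. Qed.
Lemma ext_l u1 u2 u3 : ext u1 u2 u3 ol = u3.
Proof. ext_eval. Qed.

(** * The real model inside a quaternion subalgebra *)

(* Conjugation by q on both summands of O = H + Hl: for unit q this is the extension to O,
   fixing l, of the rotation of H defined by q. *)
Definition rot (q : car HA) : Oct -> Oct :=
  fun x => (ml HA (ml HA q (fst x)) (cj HA q), ml HA (ml HA q (snd x)) (cj HA q)).
Definition unitq (a b c d : R) : Prop := a * a + b * b + c * c + d * d = 1.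

(* The automorphism i -> il, j -> -jl fixing k and l. In the basis i, j, k of Im H over
   the complex numbers generated by l (acting on the right) it is diag(l, -l, 1). *)
Definition twist : Oct -> Oct := fun x =>
  match x with (((a, b), (c, d)), ((e, f), (g, h))) =>
    (((a, - f), (g, d)), ((e, b), (- c, h))) end.

Definition h1 : car HA := ((1,0),(0,0)).
Lemma quat_eq (a b c d a' b' c' d' : R) : a = a' -> b = b' -> c = c' -> d = d' ->
  ((a,b),(c,d)) = ((a',b'),(c',d')) :> car HA.
Proof. now intros -> -> -> ->. Qed.
Ltac quat := intros; odestr; unfold h1; ounf; apply quat_eq; ring.
Lemma hmulA x y z : ml HA x (ml HA y z) = ml HA (ml HA x y) z. Proof. quat. Qed.
Lemma hmul1 x : ml HA x h1 = x. Proof. quat. Qed.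
Lemma hmulDr x y z : ml HA x (ad HA y z) = ad HA (ml HA x y) (ml HA x z). Proof. quat. Qed.
Lemma hmulDl x y z : ml HA (ad HA x y) z = ad HA (ml HA x z) (ml HA y z). Proof. quat. Qed.
Lemma hmulNr x y : ml HA x (ng HA y) = ng HA (ml HA x y). Proof. quat. Qed.
Lemma hmulNl x y : ml HA (ng HA x) y = ng HA (ml HA x y). Proof. quat. Qed.
Lemma hconjM x y : cj HA (ml HA x y) = ml HA (cj HA y) (cj HA x). Proof. quat. Qed.
Lemma hconjK x : cj HA (cj HA x) = x. Proof. quat. Qed.

(** Conjugation by q respects products and conjugates in H, hence the doubling formula: every inner
    factor q̄q cancels. *)
Lemma rot_mul q x y : ml HA (cj HA q) q = h1 ->
  omul (rot q x) (rot q y) = rot q (omul x y).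
Proof.
  intros H. assert (E : forall z, ml HA (ml HA z (cj HA q)) q = z).
  { intros z. now rewrite <- hmulA, H, hmul1. }
  destruct x as [a b], y as [c d]. 
  change (omul (a, b) (c, d)) with (ad HA (ml HA a c) (ng HA (ml HA (cj HA d) b)), ad HA (ml HA d a) (ml HA b (cj HA c))).
  unfold rot. cbn [fst snd]. 
  match goal with |- omul (?a, ?b) (?c, ?d) = _ =>
    change (omul (a, b) (c, d)) with (ad HA (ml HA a c) (ng HA (ml HA (cj HA d) b)), ad HA (ml HA d a) (ml HA b (cj HA c))) end.
  rewrite !hconjM, !hconjK, !hmulDr, !hmulDl, !hmulNr, !hmulNl, !hmulA, !E. easy.
Qed.
Lemma rot_comp p q x : rot p (rot q x) = rot (ml HA p q) x.
Proof. unfold rot. cbn [fst snd]. now rewrite !hconjM, !hmulA. Qed.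
Lemma rot_form a b c d x y :
  formR (rot ((a,b),(c,d)) x) (rot ((a,b),(c,d)) y) =
  (a * a + b * b + c * c + d * d) * (a * a + b * b + c * c + d * d) * formR x y.
Proof. unfold rot. oct. Qed.
Lemma rot_R a b c d r : rot ((a,b),(c,d)) (ofR r) = ofR ((a * a + b * b + c * c + d * d) * r).
Proof. unfold rot. oct. Qed.
Lemma rot_l a b c d : rot ((a,b),(c,d)) ol = scal (a * a + b * b + c * c + d * d) ol.
Proof. unfold rot. oct. Qed.
Lemma scal1 x : scal 1 x = x. Proof. oct. Qed.

Lemma rot_aut a b c d : unitq a b c d -> exists g, af g ol = ol /\ forall x, af g x = rot ((a,b),(c,d)) x.
Proof.
  unfold unitq. intros H. destruct (aut_of (rot ((a,b),(c,d)))) as [g Hg].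
  - unfold rot. oct.
  - intros. symmetry. apply rot_mul. unfold h1; ounf. apply quat_eq; try ring. rewrite <- H. ring.
  - intros. rewrite rot_R, H. f_equal; ring.
  - intros x y. rewrite rot_form, H. ring.
  - exists g; split; trivial. now rewrite Hg, rot_l, H, scal1.
Qed.

Lemma twist_aut : exists g, af g ol = ol /\ forall x, af g x = twist x.
Proof.
  destruct (aut_of twist) as [g Hg].
  - intros x y. odestr. unfold twist; ounf. apply oct_eq; ring.
  - intros x y. odestr. unfold twist; ounf. apply oct_eq; ring.
  - intros r. unfold twist; ounf. apply oct_eq; ring.
  - intros x y. odestr. unfold twist; ounf. ring.
  - exists g; split; trivial. rewrite Hg. unfold twist, ol; ounf. apply oct_eq; ring.
Qed.

(** These are the real points: in an adapted frame, their real orthogonality becomes orthogonality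
    over F. *)
Definition imH (w : Oct) : Prop := (exists q, w = embH q) /\ formR one w = 0.
Definition imu (w : Oct) : Prop := imH w /\ formR w w = 1.

Definition vij (a b : R) : Oct := embH ((0, a), (b, 0)).
Lemma imu_vij a b : a * a + b * b = 1 -> imu (vij a b).
Proof. intros H. repeat split; [now eexists|unfold vij; oct|]. unfold vij; ounf. lra. Qed.
Lemma imu_k : imu ok.
Proof. repeat split; [now eexists|oct|]. ounf. ring. Qed.
Lemma vij_i : vij 1 0 = oi. Proof. unfold vij; ounf. apply oct_eq; ring. Qed.
Lemma vij_j : vij 0 1 = oj. Proof. unfold vij; ounf. apply oct_eq; ring. Qed.

(** Square root on the unit circle by the half-angle formula; it makes every rotation a square. *)
Lemma sqrt_unit_complex a b : a * a + b * b = 1 -> exists c d, c * c + d * d = 1 /\ c * c - d * d = a /\ 2 * c * d = b.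
Proof.
  intros H. destruct (Req_dec a (-1)) as [->|Ha].
  (* At a = -1 the half-angle cosine is 0, and the quotient used below would be undefined. *)
  - exists 0, 1. repeat split; nra.
  - assert (Hp : 0 < (1 + a) / 2) by nra.
    pose proof (sqrt_lt_R0 _ Hp) as Hs. pose proof (sqrt_sqrt _ (Rlt_le _ _ Hp)) as E.
    set (c := sqrt _) in *. exists c, (b / (2 * c)).
    assert (E2 : b / (2 * c) * (b / (2 * c)) = (1 - a) / 2).
    { replace (b / (2 * c) * (b / (2 * c))) with (b * b / (4 * (c * c))) by (field; lra).
      rewrite E. replace (b * b) with ((1 + a) * (1 - a)) by nra. field. nra. }
    repeat split; try nra. field. lra.
Qed.

(* An abstract form of the action of Aut_F(O) on the lifted planes: [s w g] follows g while
   keeping the lift of the point w, and [ev] is the action on octonions read in a frame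
   adapted to two given points. *)
Section Core.
Variables (Gr X : Type) (mul : Gr -> Gr -> Gr) (inv : Gr -> Gr) (ev : Gr -> Oct -> Oct) (s : Oct -> Gr -> X -> X).
Hypothesis ev_inj : forall g h, (forall x, ev g x = ev h x) -> g = h.
Hypothesis ev_mul : forall g h x, ev (mul g h) x = ev g (ev h x).
Hypothesis ev_invl : forall g x, ev (inv g) (ev g x) = x.
Hypothesis ev_invr : forall g x, ev g (ev (inv g) x) = x.
Hypothesis ev_neg : forall g x, ev g (oneg x) = oneg (ev g x).
Hypothesis s_mul : forall w g h xi, imu w -> s w (mul g h) xi = s w g (s w h xi).
Hypothesis s_id : forall w g xi, imu w -> (forall x, ev g x = x) -> s w g xi = xi.
(** Both w and w' lie on the lines through x. When g fixes x, following g at either point moves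
    along one lifted line. *)
Hypothesis s_ax : forall w w' x g xi, imu w -> imu w' -> imu x -> formR w x = 0 -> formR w' x = 0 ->
  ev g x = x -> s w g xi = s w' g xi.
Hypothesis rot_ex : forall a b c d, unitq a b c d -> exists g, forall x, ev g x = rot ((a,b),(c,d)) x.
Hypothesis twist_ex : exists g, forall x, ev g x = twist x.

Lemma s_comp w g h g' h' xi : imu w -> (forall x, ev g (ev h x) = ev g' (ev h' x)) ->
  s w g (s w h xi) = s w g' (s w h' xi).
Proof.
  intros Hw H. rewrite <- !s_mul by trivial. f_equal. apply ev_inj. intros. now rewrite !ev_mul.
Qed.
Lemma s_comp1 w g h g' xi : imu w -> (forall x, ev g (ev h x) = ev g' x) ->
  s w g (s w h xi) = s w g' xi.
Proof.
  intros Hw H. rewrite <- !s_mul by trivial. f_equal. apply ev_inj. intros. now rewrite !ev_mul.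
Qed.
Lemma s_invl w g xi : imu w -> s w (inv g) (s w g xi) = xi.
Proof. intros Hw. rewrite <- s_mul by trivial. apply s_id; trivial. intros. now rewrite ev_mul. Qed.
Lemma s_invr w g xi : imu w -> s w g (s w (inv g) xi) = xi.
Proof. intros Hw. rewrite <- s_mul by trivial. apply s_id; trivial. intros. now rewrite ev_mul. Qed.

Lemma imu_i : imu oi. Proof. rewrite <- vij_i. apply imu_vij; ring. Qed.
Lemma imu_j : imu oj. Proof. rewrite <- vij_j. apply imu_vij; ring. Qed.
Hint Resolve imu_i imu_j imu_k : core.

Lemma s_swap_k w w' g xi : imu w -> imu w' -> formR w ok = 0 -> formR w' ok = 0 -> ev g ok = ok -> s w g xi = s w' g xi.
Proof. intros. now apply (s_ax w w' ok). Qed.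

Lemma ev_inv_comp g h k y : (forall x, ev g (ev h x) = ev k x) -> ev (inv k) y = ev (inv h) (ev (inv g) y).
Proof. intros E. rewrite <- (ev_invr k y) at 2. now rewrite <- E, !ev_invl. Qed.

(** [d] is the half-turn about v = ai + bj. The unit vector [w] is orthogonal to k and v, so the
    moves of [g] and [g'] (which fix k) and of [d] (which fixes v) can all be computed at [w], where
    [s] is an action. *)
Lemma halfturn_conj a b d g g' xi : a * a + b * b = 1 ->
  (forall x, ev d x = rot ((0, a), (b, 0)) x) -> ev g ok = ok -> ev g' ok = ok ->
  (forall x, ev g' (ev d x) = ev d (ev g x)) ->
  s ok d (s oi g xi) = s oi g' (s ok d xi).
Proof.
  intros H Hd Hg Hg' E. set (w := vij (- b) a).
  assert (Hw : imu w) by (apply imu_vij; lra).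
  assert (Hik : formR oi ok = 0) by oct. assert (Hwk : formR w ok = 0) by (unfold w, vij; oct).
  assert (Hv : ev d (vij a b) = vij a b).
  { rewrite Hd. transitivity (scal (a * a + b * b) (vij a b)); [unfold rot, vij; oct|].
    now rewrite H, scal1. }
  rewrite (s_swap_k oi w g), (s_swap_k oi w g'), !(s_ax ok w (vij a b) d); trivial.
  1: now apply s_comp.
  all: match goal with |- imu _ => now apply imu_vij | _ => unfold w, vij; oct end.
Qed.

(** A rotation about k is the product of the half-turns about i and about ai + bj, so
    [halfturn_conj] applies twice. *)
Lemma rotation_k_conj a b A g xi : a * a + b * b = 1 ->
  (forall x, ev A x = rot ((a, 0), (0, b)) x) -> ev g ok = ok ->
  s ok A (s oi g xi) = s oi (mul A (mul g (inv A))) (s ok A xi).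
Proof.
  intros H HA Hg.
  destruct (rot_ex 0 a b 0) as [dv Hv]; [unfold unitq; lra|].
  destruct (rot_ex 0 1 0 0) as [di Hi]; [unfold unitq; lra|].
  assert (E : forall x, ev dv (ev di x) = ev A x).
  { intros x. rewrite Hv, Hi, HA. unfold rot. odestr. ounf. apply oct_eq; ring. }
  assert (Hik : ev di ok = oneg ok) by (rewrite Hi; unfold rot; oct).
  assert (HAk : ev A ok = ok).
  { rewrite HA. transitivity (scal (a * a + b * b) ok); [unfold rot; oct|]. now rewrite H, scal1. }
  rewrite <- (s_comp1 ok dv di A) by trivial.
  rewrite <- (s_comp1 ok dv di A) by trivial.
  rewrite (halfturn_conj 1 0 di g (mul di (mul g (inv di)))); trivial; [|lra| |].
  - apply halfturn_conj with a b; trivial.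
    (* The half-turn about i negates k, so conjugation by it preserves the stabilizer of k. *)
    + rewrite !ev_mul. replace ok with (oneg (ev di ok)) at 1 by (rewrite Hik; apply negK).
      rewrite ev_neg, ev_invl, ev_neg, Hg, ev_neg, Hik. apply negK.
    + rewrite !ev_mul. rewrite <- HAk at 1. now rewrite ev_invl, Hg.
    + intros x. now rewrite !ev_mul, (ev_inv_comp dv di A), ev_invl, E.
  - rewrite !ev_mul. replace ok with (oneg (ev di ok)) at 1 by (rewrite Hik; apply negK).
    now rewrite ev_neg, ev_invl, ev_neg, Hg, ev_neg, Hik, negK.
  - intros x. now rewrite !ev_mul, ev_invl.
Qed.

(** * The defect of the twist *)

Section Defect.
Variable h : Gr.
Hypothesis h_twist : forall x, ev h x = twist x.

(* Since h fixes k, [s oi h] moves a plane along a line incident with i, while [s ok] keeps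
   the lift of k: the defect is trivial iff both agree on h. *)
Definition defect (xi : X) : X := s oi h (s ok (inv h) xi).

Lemma twist_k : ev h ok = ok.
Proof. rewrite h_twist. unfold twist; ounf. apply oct_eq; ring. Qed.

(** [r] and its conjugate [r'] by [h] both fix x0, and [h] fixes k. Hence [s ok r], [s ok r'] and
    [s oi h] may all be replaced by moves at y0, where hr' = rh concludes. *)
Lemma defect_comm x0 y0 r xi : imu x0 -> imu y0 -> formR x0 y0 = 0 ->
  formR ok x0 = 0 -> formR ok y0 = 0 ->
  ev r x0 = x0 -> ev r (ev h x0) = ev h x0 ->
  defect (s ok r xi) = s ok r (defect xi).
Proof.
  intros Hx Hy Hxy Hkx Hky Hr Hrh. unfold defect.
  pose (r' := mul (inv h) (mul r h)).
  assert (Hr' : ev r' x0 = x0) by (unfold r'; now rewrite !ev_mul, Hrh, ev_invl).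
  rewrite (s_comp ok (inv h) r r' (inv h)); trivial.
  2: { intros x. unfold r'. now rewrite !ev_mul, ev_invr. }
  assert (Hyx : formR y0 x0 = 0) by now rewrite formC.
  assert (Hik : formR oi ok = 0) by oct.
  assert (Hyk : formR y0 ok = 0) by now rewrite formC.
  rewrite (s_ax ok y0 x0 r'), !(s_ax ok y0 x0 r), !(s_swap_k oi y0 h); trivial; try apply twist_k.
  apply s_comp; trivial. intros x. unfold r'. now rewrite !ev_mul, ev_invr.
Qed.

(** A rotation about i fixes i and l, hence also the image il of i under the twist. *)
Lemma defect_comm_i a b r xi : a * a + b * b = 1 -> (forall x, ev r x = rot ((a, b), (0, 0)) x) ->
  defect (s ok r xi) = s ok r (defect xi).
Proof.
  intros H Hr. apply (defect_comm oi oj); auto; try oct; rewrite !Hr, ?h_twist.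
  - transitivity (scal (a * a + b * b) oi); [unfold rot; oct|]. now rewrite H, scal1.
  - transitivity (scal (a * a + b * b) (twist oi)).
    + unfold rot, twist; ounf; apply oct_eq; ring.
    + now rewrite H, scal1.
Qed.
Lemma defect_comm_j a b r xi : a * a + b * b = 1 -> (forall x, ev r x = rot ((a, 0), (b, 0)) x) ->
  defect (s ok r xi) = s ok r (defect xi).
Proof.
  intros H Hr. apply (defect_comm oj oi); auto; try oct; rewrite !Hr, ?h_twist.
  - transitivity (scal (a * a + b * b) oj); [unfold rot; oct|]. now rewrite H, scal1.
  - transitivity (scal (a * a + b * b) (twist oj)).
    + unfold rot, twist; ounf; apply oct_eq; ring.
    + now rewrite H, scal1.
Qed.

(** A quarter turn about i, given by the quaternion t + ti with t² = 1/2, conjugates rotations about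
    j into rotations about k. *)
Lemma defect_comm_k a b r xi : a * a + b * b = 1 -> (forall x, ev r x = rot ((a, 0), (0, b)) x) ->
  defect (s ok r xi) = s ok r (defect xi).
Proof.
  intros H Hr. set (t := sqrt (/2)).
  assert (Ht : t * t = /2) by (apply sqrt_sqrt; lra).
  destruct (rot_ex t t 0 0) as [u Hu]; [unfold unitq; lra|].
  destruct (rot_ex t (-t) 0 0) as [u' Hu']; [unfold unitq; lra|].
  destruct (rot_ex a 0 b 0) as [v Hv]; [unfold unitq; lra|].
  assert (E : forall xi, s ok r xi = s ok u (s ok v (s ok u' xi))).
  { intros eta. rewrite <- !s_mul by trivial. f_equal. apply ev_inj. intros x.
    rewrite !ev_mul, Hr, Hu, Hv, Hu'.
    rewrite !rot_comp. f_equal. clear -Ht. ounf.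
    apply quat_eq; ring_simplify [Ht]; field. }
  rewrite !E. 
  rewrite (defect_comm_i t t u), (defect_comm_j a b v), (defect_comm_i t (-t) u'); trivial; lra.
Qed.

(** The twist conjugates a rotation about k into its inverse. *)
Lemma twist_rotation a b A x : a * a + b * b = 1 ->
  (forall x, ev A x = rot ((a, 0), (0, b)) x) -> ev A (ev h (ev A x)) = ev h x.
Proof.
  intros H HA. rewrite !HA, !h_twist.
  transitivity (scal ((a * a + b * b) * (a * a + b * b)) (twist x)).
  - unfold rot, twist. odestr. ounf. apply oct_eq; ring.
  - rewrite H, Rmult_1_r. apply scal1.
Qed.

(** Commuting the defect past A replaces [h] by its conjugate [h2]. Comparison gives [s ok] of A h⁻¹
    A⁻¹ h on one side and [s oi] of h2⁻¹ h on the other; both elements are A². *)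
Lemma double_rotation a b A xi : a * a + b * b = 1 ->
  (forall x, ev A x = rot ((a, 0), (0, b)) x) -> s ok (mul A A) xi = s oi (mul A A) xi.
Proof.
  intros H HA. pose proof twist_k as Hk.
  pose proof (fun x => twist_rotation a b A x H HA) as T.
  pose (h2 := mul A (mul h (inv A))).
  (* The argument is chosen so that the left side collapses to [s oi h xi]. *)
  pose proof (defect_comm_k a b A (s ok (mul (inv A) h) xi) H HA) as E.
  unfold defect in E. rewrite (rotation_k_conj a b A h) in E by trivial. fold h2 in E.
  assert (E1 : s ok (inv h) (s ok A (s ok (mul (inv A) h) xi)) = xi).
  { rewrite <- !s_mul by trivial. apply s_id; trivial. intros x. now rewrite !ev_mul, ev_invr, ev_invl. }
  rewrite E1 in E. rewrite <- !(s_mul ok) in E by trivial.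
  apply (f_equal (s oi (inv h2))) in E. rewrite s_invl in E by auto.
  rewrite <- s_mul in E by auto.
  transitivity (s oi (mul (inv h2) h) xi).
  - rewrite E. f_equal. apply ev_inj. intros x. rewrite !ev_mul.
    now rewrite <- (T x), !ev_invl.
  - f_equal. apply ev_inj. intros x. rewrite !ev_mul.
    rewrite <- (ev_invl h2 (ev A (ev A x))). f_equal.
    unfold h2. rewrite !ev_mul, ev_invl. symmetry. apply T.
Qed.
End Defect.

(** For stabilizers of j this is the line axiom, as j is orthogonal to i and k. A doubled rotation
    [B] taking j to ai + bj carries it over by conjugation. *)
Lemma vij_stabilizer a b g xi : a * a + b * b = 1 -> ev g (vij a b) = vij a b -> s ok g xi = s oi g xi.
Proof.
  intros H Hg. destruct twist_ex as [h Hh].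
  (* The required angle has cosine b and sine -a. The quaternion c' + d'k turns by twice its
     argument and [B] squares it, whence two square roots. *)
  destruct (sqrt_unit_complex b (-a)) as (c & d & Hcd & E1 & E2); [lra|].
  destruct (sqrt_unit_complex c d Hcd) as (c' & d' & Hcd' & E1' & E2').
  destruct (rot_ex c' 0 0 d') as [A HA]; [unfold unitq; lra|].
  set (B := mul A A).
  assert (HB : forall eta, s ok B eta = s oi B eta) by (intros; now apply (double_rotation h Hh c' d')).
  assert (HB' : forall eta, s ok (inv B) eta = s oi (inv B) eta).
  { intros eta. rewrite <- (s_invl oi B (s ok _ _)) by auto. rewrite <- HB, s_invr by auto. easy. }
  assert (HBj : ev B oj = vij a b).
  { unfold B. rewrite ev_mul, !HA, <- vij_j.
    transitivity (vij (- (2 * (c' * c' - d' * d') * (2 * c' * d')))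
       ((c' * c' - d' * d') * (c' * c' - d' * d') - (2 * c' * d') * (2 * c' * d'))).
    - unfold rot, vij. ounf. apply oct_eq; ring.
    - rewrite E1', E2', E1, E2. f_equal. ring. }
  pose (g0 := mul (inv B) (mul g B)).
  assert (Hg0 : ev g0 oj = oj) by (unfold g0; now rewrite !ev_mul, HBj, Hg, <- HBj, ev_invl).
  assert (E : g = mul B (mul g0 (inv B))).
  { apply ev_inj. intros x. unfold g0. now rewrite !ev_mul, !ev_invr. }
  rewrite E, !s_mul by auto. rewrite HB, HB'. f_equal.
  apply (s_ax ok oi oj); auto; oct.
Qed.
End Core.

(** * Automorphisms fixing F, planes and adapted frames *)

Lemma sig_eq (T : Type) (P : T -> Prop) (a b : sig P) : proj1_sig a = proj1_sig b -> a = b.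
Proof.
  destruct a as [a Ha], b as [b Hb]; cbn. intros <-. f_equal. apply proof_irrelevance.
Qed.

Definition fixesF (c : FAcase) (g : aut) : Prop := forall t, inF c t -> af g t = t.
(** Over the reals this is the compact group G2, over the complex numbers its subgroup SU(3). *)
Definition Gr (c : FAcase) : Type := { g : aut | fixesF c g }.
Definition gf {c} (g : Gr c) : Oct -> Oct := af (proj1_sig g).

Lemma fixesF_comp c g h : fixesF c g -> fixesF c h -> fixesF c (acomp g h).
Proof. intros Hg Hh t Ht. cbn. now rewrite Hh, Hg. Qed.
Lemma fixesF_inv c g : fixesF c g -> fixesF c (ainv g).
Proof. intros Hg t Ht. cbn. rewrite <- (Hg t Ht) at 1. apply afK. Qed.
Definition gmul {c} (g h : Gr c) : Gr c :=
  exist _ (acomp (proj1_sig g) (proj1_sig h)) (fixesF_comp c _ _ (proj2_sig g) (proj2_sig h)).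
Definition ginv {c} (g : Gr c) : Gr c :=
  exist _ (ainv (proj1_sig g)) (fixesF_inv c _ (proj2_sig g)).
Definition gone {c} : Gr c := exist _ aid (fun t _ => eq_refl).

Lemma gf_mul c (g h : Gr c) x : gf (gmul g h) x = gf g (gf h x). Proof. easy. Qed.
Lemma gf_invl c (g : Gr c) x : gf (ginv g) (gf g x) = x. Proof. apply afK. Qed.
Lemma gf_invr c (g : Gr c) x : gf g (gf (ginv g) x) = x. Proof. apply abK. Qed.
Lemma gf_inj c (g h : Gr c) : (forall x, gf g x = gf h x) -> g = h.
Proof. intros H. now apply sig_eq, aut_eq. Qed.
Lemma gf_form c (g : Gr c) x y : formR (gf g x) (gf g y) = formR x y. Proof. apply af_form. Qed.
Lemma gf_F c (g : Gr c) t : inF c t -> gf g t = t. Proof. apply (proj2_sig g). Qed.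
Lemma gf_mulo c (g : Gr c) x y : gf g (omul x y) = omul (gf g x) (gf g y). Proof. apply af_mul. Qed.
Lemma gf_scal c (g : Gr c) r x : gf g (scal r x) = scal r (gf g x). Proof. apply af_scal. Qed.
Lemma gf_add c (g : Gr c) x y : gf g (oadd x y) = oadd (gf g x) (gf g y). Proof. apply af_add. Qed.

Lemma inF_R c r : inF c (ofR r).
Proof. destruct c; cbn; [now exists r|]. now exists (r, 0). Qed.
Lemma inF_one c : inF c one. Proof. apply inF_R. Qed.
Lemma inF_i : inF CO oi. Proof. now exists (0, 1). Qed.
Lemma inA_H c q : inA c (embH q).
Proof. destruct c; cbn; trivial. now exists q. Qed.
Lemma inA_F c t : inF c t -> inA c t.
Proof. destruct c; cbn; trivial. intros [r ->]. now exists ((r,0),(0,0)). Qed.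
Lemma inA_add c x y : inA c x -> inA c y -> inA c (oadd x y).
Proof.
  destruct c; cbn; trivial. intros [p ->] [q ->]. exists (ad HA p q). 
  change (zr HA) with ((0,0),(0,0)). odestr; ounf; apply oct_eq; ring.
Qed.
Lemma inA_mul c x y : inA c x -> inA c y -> inA c (omul x y).
Proof.
  destruct c; cbn; trivial. intros [p ->] [q ->]. exists (ml HA p q). odestr; ounf; apply oct_eq; ring.
Qed.
Lemma inA_scal c r x : inA c x -> inA c (scal r x).
Proof. intros H. apply inA_mul; trivial. apply inA_F, inF_R. Qed.

Lemma form_RH x y : form RH x y = ozero <-> formR x y = 0.
Proof.
  cbn. split; intros H; [|now rewrite H].
  apply (f_equal (fun z : Oct => fst (fst (fst z)))) in H. exact H.
Qed.
Lemma form_CO_E x y : form CO x y = ofC (formR x y, formR (omul x oi) y).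
Proof. unfold form. f_equal. odestr; ounf. f_equal; ring. Qed.
Lemma form_CO x y : form CO x y = ozero <-> formR x y = 0 /\ formR (omul x oi) y = 0.
Proof.
  rewrite form_CO_E. split; [|now intros [-> ->]].
  intros H. split.
  - apply (f_equal (fun z : Oct => fst (fst (fst z)))) in H. exact H.
  - apply (f_equal (fun z : Oct => snd (fst (fst z)))) in H. exact H.
Qed.
Lemma form_formR c x y x' y' : form c x y = form c x' y' -> formR x y = formR x' y'.
Proof.
  intros H. destruct c; [|rewrite !form_CO_E in H];
  apply (f_equal (fun z : Oct => fst (fst (fst z)))) in H; exact H.
Qed.
Lemma form_sym c x y : form c x y = ozero -> form c y x = ozero.
Proof.
  destruct c; rewrite ?form_RH, ?form_CO.
  - now rewrite formC.
  - intros [H1 H2]. rewrite formC. split; trivial.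
    transitivity (- formR (omul x oi) y); [oct|rewrite H2; ring].
Qed.
Lemma gf_formF c (g : Gr c) x y : form c (gf g x) (gf g y) = form c x y.
Proof.
  destruct c.
  - cbn. now rewrite gf_form.
  - rewrite !form_CO_E, gf_form. rewrite <- (gf_F CO g oi inF_i) at 1. now rewrite <- gf_mulo, gf_form.
Qed.

Lemma pu_RH B x : PuF RH B x <-> B x /\ formR one x = 0.
Proof.
  unfold PuF. split; intros [H1 H2]; split; trivial.
  - apply H2, inF_R.
  - intros t [r ->]. now rewrite form_ofR, H2, Rmult_0_r.
Qed.
Lemma form_ofC a b x : formR (ofC (a, b)) x = a * formR one x + b * formR oi x. Proof. oct. Qed.
Lemma pu_CO B x : PuF CO B x <-> B x /\ formR one x = 0 /\ formR oi x = 0.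
Proof.
  unfold PuF. split; intros [H1 H2]; split; trivial.
  - split; apply H2; [apply inF_R|apply inF_i].
  - intros t [[a b] ->]. rewrite form_ofC. destruct H2 as [-> ->]. ring.
Qed.
Notation PuO c := (PuF c (fun _ => True)).
Notation PuA c := (PuF c (inA c)).
Lemma PuA_O c x : PuA c x -> PuO c x.
Proof. now intros [_ H]; split. Qed.
Lemma PuO_gf c (g : Gr c) x : PuO c x -> PuO c (gf g x).
Proof.
  intros [_ H]. split; trivial. intros t Ht. rewrite <- (gf_F c g t Ht), gf_form. auto.
Qed.
Lemma PuF_scal c r x : PuA c x -> PuA c (scal r x).
Proof.
  intros [H1 H]. split; [now apply inA_scal|]. intros t Ht. rewrite formZr, H; trivial. ring.
Qed.
Lemma PuO_scal c r x : PuO c x -> PuO c (scal r x).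
Proof.
  intros [H1 H]. split; trivial. intros t Ht. rewrite formZr, H; trivial. ring.
Qed.
Lemma form_scal_r c r x y : form c x y = ozero -> form c x (scal r y) = ozero.
Proof.
  destruct c; rewrite ?form_RH, ?form_CO, !formZr; [intros ->|intros [-> ->]]; [|split]; ring.
Qed.
Lemma form_scal_l c r x y : form c x y = ozero -> form c (scal r x) y = ozero.
Proof. intros. now apply form_sym, form_scal_r, form_sym. Qed.
Lemma onorm_sqr x : onorm x * onorm x = formR x x.
Proof. apply sqrt_sqrt, form_ge0. Qed.

Definition planefun {c} (g : Gr c) (x : Oct) : Oct :=
  if excluded_middle_informative (inA c x) then gf g x else ozero.
Lemma planefunE c (g : Gr c) x : inA c x -> planefun g x = gf g x.
Proof. intros H. unfold planefun. now destruct excluded_middle_informative. Qed.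
Lemma planefun_sharp c (g : Gr c) : sharp c (planefun g).
Proof.
  repeat split; intros x y Hx Hy; rewrite ?(planefunE c g x Hx), ?(planefunE c g y Hy).
  - rewrite planefunE by now apply inA_add. apply gf_add.
  - rewrite planefunE by (apply inA_mul; [easy|now apply inA_F]). now rewrite gf_mulo, (gf_F c g y Hy).
  - rewrite planefunE by now apply inA_mul. apply gf_mulo.
  - apply gf_formF.
Qed.
Lemma planefun_out c (g : Gr c) x : ~ inA c x -> planefun g x = ozero.
Proof. intros H. unfold planefun. now destruct excluded_middle_informative. Qed.
Definition plane {c} (g : Gr c) : Gplane c :=
  exist _ (planefun g) (conj (planefun_sharp c g) (planefun_out c g)).

(** Multiplicativity of the norm applied to x(x - 1) = 0. It shows that sharp morphisms preserve
    1. *)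
Lemma idempotent_one x : omul x x = x -> formR x x = 1 -> x = one.
Proof.
  intros H1 H2. apply sub_eq0, form_eq0.
  assert (E : omul x (oadd x (oneg one)) = ozero).
  { rewrite mulDr, mulNr, mulo1, H1. generalize x. oct. }
  pose proof (norm_mul x (oadd x (oneg one))) as N. rewrite E, H2, form0r in N. lra.
Qed.

(** Over the complex numbers b must avoid 1, i, u and ui; over the reals 1 and u suffice, and zeros
    fill the remaining places. *)
Lemma exists_orth_PuO c u : PuO c u -> formR u u = 1 -> exists b, PuO c b /\ formR b b = 1 /\ form c u b = ozero.
Proof.
  intros Hu U.
  assert (O1 : formR one one = 1) by oct.
  assert (Oi : formR oi oi = 1) by oct. assert (O1i : formR one oi = 0) by oct.
  destruct c.
  - apply pu_RH in Hu. destruct (exists_orth one u ozero ozero) as (b & B & B1 & B2 & _ & _);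
      unfold unit_or_zero; rewrite ?form0r; try tauto.
    exists b. now rewrite pu_RH, form_RH.
  - apply pu_CO in Hu. destruct Hu as (_ & H1 & Hi).
    destruct (exists_orth one oi u (omul u oi)) as (b & B & B1 & B2 & B3 & B4);
      unfold unit_or_zero; rewrite ?norm_mul, ?U, ?Oi; try tauto; try (left; ring).
    + transitivity (- formR oi u); [oct|rewrite Hi; ring].
    + transitivity (formR one u); [oct|rewrite H1; ring].
    + oct.
    + exists b. now rewrite pu_CO, form_CO.
Qed.

(** * Transitivity and generation by point stabilizers *)

Definition e1 (c : FAcase) := match c with RH => oi | CO => oj end.
Definition e2 (c : FAcase) := match c with RH => oj | CO => ol end.
Definition e3 (c : FAcase) := match c with RH => ok | CO => omul oj ol end.

Lemma anticomm_i a : formR one a = 0 -> formR oi a = 0 -> omul oi a = oneg (omul a oi).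
Proof.
  intros H1 Hi. rewrite (mul_orth oi) by (try apply oct; try oct; now rewrite formC).
  now rewrite (conjN a H1), mulNr, negK.
Qed.

Lemma triple_CO a b : PuO CO a -> PuO CO b -> formR a a = 1 -> formR b b = 1 -> form CO a b = ozero ->
  triple oi a b.
Proof.
  rewrite !pu_CO, form_CO. intros (_ & A1 & Ai) (_ & B1 & Bi) A B [H1 H2].
  repeat split; trivial; try oct. 
  rewrite anticomm_i, formNl, H2 by trivial. ring.
Qed.

Lemma form_mul_l x y z : formR (omul x y) (omul x z) = formR x x * formR y z.
Proof. oct. Qed.
Lemma form_mul_r x y z : formR (omul y x) (omul z x) = formR y z * formR x x.
Proof. oct. Qed.

(** Over the reals (a, b) is completed by a unit vector orthogonal to 1, a, b and ab; over the
    complex numbers (i, a, b) is already a basic triple, and its automorphism fixes i. *)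
Lemma adapted_frame c a b : PuO c a -> PuO c b -> formR a a = 1 -> formR b b = 1 -> form c a b = ozero ->
  exists g : Gr c, gf g (e1 c) = a /\ gf g (e2 c) = b.
Proof.
  intros Ha Hb A B H. destruct c.
  - apply pu_RH in Ha, Hb. apply form_RH in H. destruct Ha as [_ Ha], Hb as [_ Hb].
    destruct (exists_orth one a b (omul a b)) as (d & D & D1 & D2 & D3 & D4);
      unfold unit_or_zero; rewrite ?norm_mul, ?A, ?B; try tauto; try (left; ring).
    + left. oct.
    + rewrite re_mul, H by trivial. ring.
    + rewrite <- (mulo1 a) at 1. rewrite form_mul_l, Hb. ring.
    + rewrite <- (mul1o b) at 1. rewrite form_mul_r, Ha. ring.
    + destruct (ext_aut a b d) as [g Hg]; [repeat split; trivial|].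
      unshelve eexists (exist _ g _).
      * intros t [r ->]. apply af_R.
      * unfold gf; cbn. now rewrite !Hg, ext_i, ext_j.
  - destruct (ext_aut oi a b (triple_CO a b Ha Hb A B H)) as [g Hg].
    unshelve eexists (exist _ g _).
    + intros t [[x y] ->]. replace (ofC (x, y)) with (oadd (ofR x) (omul (ofR y) oi)) by oct.
      now rewrite af_add, af_mul, !af_R, Hg, ext_i.
    + unfold gf; cbn. now rewrite !Hg, ext_j, ext_l.
Qed.

Lemma two_transitive c a b a' b' :
  PuO c a -> PuO c b -> formR a a = 1 -> formR b b = 1 -> form c a b = ozero ->
  PuO c a' -> PuO c b' -> formR a' a' = 1 -> formR b' b' = 1 -> form c a' b' = ozero ->
  exists g : Gr c, gf g a = a' /\ gf g b = b'.
Proof.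
  intros Pa Pb A B H Pa' Pb' A' B' H'.
  destruct (adapted_frame c a b) as (g & G1 & G2); trivial.
  destruct (adapted_frame c a' b') as (g' & G1' & G2'); trivial.
  exists (gmul g' (ginv g)). rewrite <- G1, <- G2, !gf_mul, !gf_invl. easy.
Qed.

Lemma PuA_e c : PuA c (e1 c) /\ PuA c (e2 c) /\ PuA c (e3 c).
Proof.
  destruct c; cbn [e1 e2 e3]; rewrite ?pu_RH, ?pu_CO; repeat split; trivial; try oct.
  all: now eexists.
Qed.
Lemma norm_e c : formR (e1 c) (e1 c) = 1 /\ formR (e2 c) (e2 c) = 1 /\ formR (e3 c) (e3 c) = 1.
Proof. destruct c; cbn [e1 e2 e3]; repeat split; oct. Qed.
Lemma form_e c : form c (e1 c) (e2 c) = ozero /\ form c (e2 c) (e3 c) = ozero.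
Proof. destruct c; cbn [e1 e2 e3]; rewrite ?form_RH, ?form_CO; repeat split; oct. Qed.

Lemma hermitian_decomposition c u : exists z, inF c z /\ form c (e2 c) (oadd u (oneg (omul (e2 c) z))) = ozero.
Proof.
  destruct c; cbn [e2].
  - exists (ofR (formR oj u)). split; [apply inF_R|]. rewrite form_RH. oct.
  - exists (ofC (formR ol u, formR (omul ol oi) u)). split; [now eexists|]. rewrite form_CO. split; oct.
Qed.
Lemma form_e1_combination c z r : inF c z -> form c (e1 c) (oadd (omul (e2 c) z) (scal r (e3 c))) = ozero.
Proof.
  destruct c; cbn [e1 e2 e3 inF].
  - intros [x ->]. rewrite form_RH. oct.
  - intros [[x y] ->]. rewrite form_CO. split; oct.
Qed.

Lemma normalize c u : PuO c u -> u <> ozero -> exists r v, 0 < r /\ u = scal r v /\ PuO c v /\ formR v v = 1 /\ (PuA c u -> PuA c v).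
Proof.
  intros H H0. destruct (unit_scal u H0) as (r & R1 & R2). exists (/ r), (scal r u).
  split; [now apply Rinv_0_lt_compat|]. split; [|split; [|split]].
  - transitivity (scal (/ r * r) u); [|oct]. rewrite Rinv_l by lra. now rewrite scal1.
  - now apply PuO_scal.
  - rewrite formZr, formZl, <- R1. ring.
  - apply PuF_scal.
Qed.

(** An Euler angle decomposition. [h] fixes e2 and brings g e2 into the span of e2 and e3,
    orthogonal to e1; then [k] fixes e1 and brings it to e2. So khg fixes e2. *)
Lemma stabilizers_generate c (g : Gr c) : exists g1 g2 g3, g = gmul g1 (gmul g2 g3) /\ gf g1 (e2 c) = e2 c /\ gf g2 (e1 c) = e1 c /\ gf g3 (e2 c) = e2 c.
Proof.
  destruct (PuA_e c) as (P1 & P2 & P3). destruct (norm_e c) as (N1 & N2 & N3).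
  destruct (form_e c) as (F12 & F23). pose proof (form_sym _ _ _ F12) as F21.
  apply PuA_O in P1, P2, P3.
  set (u := gf g (e2 c)).
  assert (Pu : PuO c u) by now apply PuO_gf.
  assert (Nu : formR u u = 1) by (unfold u; now rewrite gf_form).
  destruct (hermitian_decomposition c u) as (z & Hz & Hzu).
  set (v := oadd u (oneg (omul (e2 c) z))) in *.
  assert (Eu : u = oadd (omul (e2 c) z) v).
  { unfold v. generalize (omul (e2 c) z). generalize u. oct. }
  assert (Pv : PuO c v).
  { split; trivial. intros t Ht. unfold v. rewrite formDr, formNr. destruct Pu as [_ Pu]. rewrite Pu by trivial.
    replace (formR t (omul (e2 c) z)) with 0; [ring|].
    destruct c; cbn [e2 inF] in *.
    - destruct Hz as [r ->], Ht as [r' ->]. oct.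
    - destruct Hz as [[r1 r2] ->], Ht as [[r3 r4] ->]. oct. }
  assert (Hh : exists (h : Gr c) r, gf h (e2 c) = e2 c /\ gf h v = scal r (e3 c)).
  { destruct (classic (v = ozero)) as [->|V0].
    - exists gone, 0. split; [easy|]. rewrite scal0. easy.
    - destruct (normalize c v Pv V0) as (r & v0 & Hr & Ev & Pv0 & Nv0 & _).
      destruct (two_transitive c (e2 c) v0 (e2 c) (e3 c)) as (h & H1 & H2); trivial.
      + replace v0 with (scal (/ r) v); [now apply form_scal_r|].
        rewrite Ev. transitivity (scal (/ r * r) v0); [oct|]. rewrite Rinv_l by lra. apply scal1.
      + exists h, r. split; trivial. now rewrite Ev, gf_scal, H2. }
  destruct Hh as (h & r & Hh1 & Hh2).
  assert (Hu' : form c (e1 c) (gf h u) = ozero).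
  { rewrite Eu, gf_add, gf_mulo, Hh1, Hh2, gf_F by trivial. now apply form_e1_combination. }
  destruct (two_transitive c (e1 c) (gf h u) (e1 c) (e2 c)) as (k & K1 & K2); trivial.
  { now apply PuO_gf. }
  { now rewrite gf_form. }
  exists (ginv h), (ginv k), (gmul k (gmul h g)). repeat split.
  - apply gf_inj. intros x. now rewrite !gf_mul, !gf_invl.
  - rewrite <- Hh1 at 1. apply gf_invl.
  - rewrite <- K1 at 1. apply gf_invl.
  - rewrite !gf_mul. exact K2.
Qed.

(** On H the morphism is determined by the images of i and j. Together with a suitable third vector
    these form a basic triple, whose automorphism extends it. *)
Lemma sharp_plane c phi : sharp c phi -> exists g : Gr c, forall x, inA c x -> phi x = gf g x.
Proof.
  intros (Hadd & HF & Hmul & Hform).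
  assert (Hiso : forall x y, inA c x -> inA c y -> formR (phi x) (phi y) = formR x y).
  { intros x y Hx Hy. apply (form_formR c). auto. }
  assert (A1 : inA c one) by apply inA_F, inF_R.
  assert (Ai : inA c oi) by apply (inA_H c ((0,1),(0,0))).
  assert (Aj : inA c oj) by apply inA_H.
  assert (E1 : phi one = one).
  { apply idempotent_one; [rewrite <- Hmul; trivial; now rewrite mulo1|]. rewrite Hiso; trivial. oct. }
  assert (Et : forall t, inF c t -> phi t = t).
  { intros t Ht. rewrite <- (mul1o t) at 1. rewrite HF by trivial. now rewrite E1, mul1o. }
  assert (ER : forall r, phi (ofR r) = ofR r) by (intros; apply Et, inF_R).
  assert (AR : forall r, inA c (ofR r)) by (intros; apply inA_F, inF_R).
  set (u1 := phi oi). set (u2 := phi oj).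
  assert (EH : forall q, phi (embH q) = dbl CA (dbl RA ofR u1) u2 q).
  { intros [[a b] [d e]].
    transitivity (phi (oadd (oadd (ofR a) (omul (ofR b) oi)) (omul (oadd (ofR d) (omul (ofR e) oi)) oj))).
    - f_equal. oct.
    - repeat (rewrite Hadd || rewrite Hmul); repeat (apply inA_add || apply inA_mul); trivial.
      now rewrite !ER. }
  assert (I1 : formR one u1 = 0) by (rewrite <- E1; unfold u1; rewrite Hiso; trivial; oct).
  assert (I2 : formR one u2 = 0) by (rewrite <- E1; unfold u2; rewrite Hiso; trivial; oct).
  assert (N1 : formR u1 u1 = 1) by (unfold u1; rewrite Hiso; trivial; oct).
  assert (N2 : formR u2 u2 = 1) by (unfold u2; rewrite Hiso; trivial; oct).
  assert (I12 : formR u1 u2 = 0) by (unfold u1, u2; rewrite Hiso; trivial; oct).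
  (* Over the reals any admissible [u3] will do, as only H is constrained; over the complex numbers
     the image of l is prescribed. *)
  assert (Hex : exists u3, triple u1 u2 u3 /\ (c = CO -> u3 = phi ol)).
  { destruct c.
    - destruct (exists_orth one u1 u2 (omul u1 u2)) as (d & D & D1 & D2 & D3 & D4);
        unfold unit_or_zero; rewrite ?norm_mul, ?N1, ?N2; try tauto; try (left; ring).
      + left. oct.
      + rewrite re_mul, I12 by trivial. ring.
      + rewrite <- (mulo1 u1) at 1. rewrite form_mul_l, I2. ring.
      + rewrite <- (mul1o u2) at 1. rewrite form_mul_r, I1. ring.
      + exists d. now repeat split.
    - exists (phi ol). split; trivial.
      repeat split; trivial; try (rewrite <- E1); unfold u1, u2; rewrite <- ?Hmul, ?Hiso by easy; oct. }
  destruct Hex as (u3 & HT & H3).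
  destruct (ext_aut u1 u2 u3 HT) as [g Hg].
  assert (Hpg : forall x, inA c x -> phi x = af g x).
  { destruct c; cbn [inA].
    - intros x [q ->]. rewrite Hg. change ((q, zr HA)) with (embH q). now rewrite EH, ext_H.
    - intros [q r] _. rewrite Hg. unfold ext. unfold dbl at 1; cbn [fst snd].
      rewrite H3, <- !EH, <- Hmul, <- Hadd by easy. f_equal.
      odestr; ounf; apply oct_eq; ring. }
  unshelve eexists (exist _ g _); trivial.
  intros t Ht. rewrite <- Hpg; auto. now apply inA_F.
Qed.

Lemma plane_surj c (Phi : Gplane c) : exists g, Phi = plane g.
Proof.
  destruct Phi as [phi [Hs Ho]]. destruct (sharp_plane c phi Hs) as [g Hg]. exists g.
  apply sig_eq; cbn. apply functional_extensionality. intros x. unfold planefun.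
  destruct excluded_middle_informative; auto.
Qed.

Lemma exists_orth_PuA c p : PuA c p -> formR p p = 1 -> exists b, PuA c b /\ formR b b = 1 /\ form c p b = ozero.
Proof.
  intros Hp U. destruct c; [|apply (exists_orth_PuO CO p Hp U)].
  apply pu_RH in Hp. destruct Hp as [[[[a b] [d e]] ->] Hp].
  assert (a = 0) as -> by (rewrite <- Hp; ounf; ring).
  (* In H the vector -di + bj is orthogonal to p = bi + dj + ek; if p is a multiple of k, i is taken
     instead. *)
  set (v := embH ((0, if Req_dec_T b 0 then (if Req_dec_T d 0 then 1 else - d) else - d),
                  (if Req_dec_T b 0 then (if Req_dec_T d 0 then 0 else b) else b, 0))).
  assert (V0 : v <> ozero).
  { unfold v, embH, ozero. intros E. injection E. destruct (Req_dec_T b 0), (Req_dec_T d 0); intros; lra. }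
  assert (Pv : PuA RH v).
  { rewrite pu_RH. split; [now eexists|]. unfold v; oct. }
  destruct (normalize RH v (PuA_O _ _ Pv) V0) as (r & w & Hr & Ew & _ & Nw & Pw).
  exists w. split; auto. split; trivial.
  replace w with (scal (/ r) v).
  - apply form_scal_r. rewrite form_RH. unfold v. destruct (Req_dec_T b 0), (Req_dec_T d 0); subst; oct.
  - rewrite Ew. transitivity (scal (/ r * r) w); [oct|]. rewrite Rinv_l by lra. apply scal1.
Qed.

Lemma line_in_plane c x u : PuA c x -> PuO c u -> onorm x = onorm u -> onorm x <> 0 ->
  exists g : Gr c, gf g x = u.
Proof.
  intros Hx Hu E N.
  assert (Exu : formR x x = formR u u) by now rewrite <- !onorm_sqr, E.
  assert (X0 : x <> ozero).
  { intros ->. apply N. unfold onorm. rewrite form0r. apply sqrt_0. }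
  destruct (unit_scal x X0) as (r & R1 & R2).
  assert (N1 : formR (scal r x) (scal r x) = 1) by (rewrite formZr, formZl; lra).
  assert (N2 : formR (scal r u) (scal r u) = 1) by (rewrite formZr, formZl, <- Exu; lra).
  destruct (exists_orth_PuO c (scal r x)) as (b & B1 & B2 & B3); trivial.
  { now apply PuO_scal, PuA_O. }
  destruct (exists_orth_PuO c (scal r u)) as (b' & B1' & B2' & B3'); trivial.
  { now apply PuO_scal. }
  destruct (two_transitive c (scal r x) b (scal r u) b') as (g & G & _); trivial.
  { now apply PuO_scal, PuA_O. }
  { now apply PuO_scal. }
  exists g. rewrite gf_scal in G.
  apply (f_equal (scal (/ r))) in G.
  assert (S : forall y, scal (/ r) (scal r y) = y).
  { intros y. transitivity (scal (/ r * r) y); [oct|]. rewrite Rinv_l by lra. apply scal1. }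
  now rewrite !S in G.
Qed.

Lemma form_phase p x a b :
  formR (omul p oi) (omul x (ofC (a, b))) = a * formR (omul p oi) x + b * formR p x.
Proof. oct. Qed.

(** Over the complex numbers the phase makes (p|xt) real: t is the conjugate of (p|x), or 1 if (p|x)
    = 0. *)
Lemma phase_exists c p x : x <> ozero ->
  exists t, inF c t /\ omul x t <> ozero /\ (c = CO -> formR (omul p oi) (omul x t) = 0).
Proof.
  intros H. destruct c.
  - exists one. split; [apply inF_one|]. split; [now rewrite mulo1|easy].
  - set (a := formR p x). set (b := formR (omul p oi) x).
    destruct (Req_dec (a * a + b * b) 0) as [E|E].
    + exists one. split; [apply inF_one|]. rewrite mulo1. split; trivial. intros _. fold b. nra.
    + exists (ofC (a, - b)). split; [now eexists|]. split.
      * intros E0. apply H, form_eq0. pose proof (norm_mul x (ofC (a, - b))) as N.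
        rewrite E0, form0r in N. 
        replace (formR (ofC (a, - b)) (ofC (a, - b))) with (a * a + b * b) in N by oct.
        symmetry in N. apply Rmult_integral in N. tauto.
      * intros _. rewrite form_phase. fold a b. ring.
Qed.

(** Coordinates with p at i and x, up to a scalar of F, in the plane <i,j>. [k] need not fix F: in
    the complex case the frame built below sends l to i, so automorphisms fixing l become
    F-automorphisms. *)
Record real_frame (c : FAcase) (p x : Oct) (k : aut) : Prop := {
  rf_i : af k oi = p;
  rf_x : exists a b r t, a * a + b * b = 1 /\ inF c t /\ af k (vij a b) = scal r (omul x t);
  rf_pu : forall w, imH w -> PuA c (af k w);
  rf_form : forall w w', imH w -> imH w' -> formR w w' = 0 -> form c (af k w) (af k w') = ozero;
  rf_fix : forall g, af g ol = ol -> exists g' : Gr c, forall y, gf g' (af k y) = af k (af g y) }.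

(** Gram-Schmidt on p and the rescaled x gives real coefficients, thanks to the phase. *)
Lemma real_frame_exists c p x : PuA c p -> formR p p = 1 -> PuA c x -> x <> ozero ->
  exists k, real_frame c p x k.
Proof.
  intros Hp Np Hx X0.
  destruct (phase_exists c p x X0) as (t & Ht & T0 & Htp).
  assert (Hxt : PuA c (omul x t)).
  { destruct Hx as [Hx1 Hx2]. split; [apply inA_mul; trivial; now apply inA_F|].
    intros z Hz. destruct c.
    - destruct Ht as [r ->], Hz as [r' ->]. transitivity (r * r' * formR one x); [oct|].
      unfold one; rewrite Hx2; [ring|apply inF_R].
    - destruct Ht as [[a b] ->], Hz as [[a' b'] ->]. 
      transitivity ((a' * a + b' * b) * formR one x + (b' * a - a' * b) * formR oi x); [oct|].
      unfold one; rewrite !Hx2; [ring|apply inF_i|apply (inF_R CO)]. }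
  destruct (normalize c (omul x t) (PuA_O _ _ Hxt) T0) as (r & y & Hr & Ey & _ & Ny & Py).
  specialize (Py Hxt).
  assert (Ey' : y = scal (/ r) (omul x t)).
  { rewrite Ey. transitivity (scal (/ r * r) y); [rewrite Rinv_l by lra; now rewrite scal1|oct]. }
  set (a := formR p y). set (v := oadd y (oneg (scal a p))).
  assert (Pv : PuA c v).
  { unfold v. replace (oneg (scal a p)) with (scal (- a) p) by oct. destruct Py as [Y1 Y2], Hp as [P1 P2].
    split; [apply inA_add; trivial; now apply inA_scal|]. intros z Hz. rewrite formDr, formZr, Y2, P2; trivial. ring. }
  assert (Fv : form c p v = ozero).
  { assert (F0 : formR p v = 0) by (unfold v; rewrite formDr, formNr, formZr, Np; unfold a; ring).
    destruct c; [now rewrite form_RH|]. rewrite form_CO. split; trivial.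
    unfold v. rewrite formDr, formNr, formZr, Ey', formZr, Htp by trivial.
    replace (formR (omul p oi) p) with 0; [ring|oct]. }
  assert (Ev0 : y = oadd (scal a p) v) by (unfold v; clear; generalize (scal a p) y; oct).
  clearbody v a.
  assert (Hq : exists q b, PuA c q /\ formR q q = 1 /\ form c p q = ozero /\ v = scal b q).
  { destruct (classic (v = ozero)) as [V0|V0].
    (* Here y is a real multiple of p, and any q orthogonal to p completes the frame. *)
    - destruct (exists_orth_PuA c p Hp Np) as (q & Q1 & Q2 & Q3). exists q, 0. rewrite scal0.
      exact (conj Q1 (conj Q2 (conj Q3 V0))).
    - destruct (normalize c v (PuA_O _ _ Pv) V0) as (s & q & Hs & Eq & _ & Nq & Pq).
      exists q, s. refine (conj (Pq Pv) (conj Nq (conj _ Eq))).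
      replace q with (scal (/ s) v); [now apply form_scal_r|].
      rewrite Eq. transitivity (scal (/ s * s) q); [oct|rewrite Rinv_l by lra; now rewrite scal1]. }
  destruct Hq as (q & b & Pq & Nq & Fq & Ev).
  assert (F0 : formR p q = 0) by (clear - Fq; destruct c; [exact (proj1 (form_RH p q) Fq)|exact (proj1 (proj1 (form_CO p q) Fq))]).
  assert (Eyq : y = oadd (scal a p) (scal b q)).
  { now rewrite <- Ev. }
  assert (Hab : a * a + b * b = 1).
  { rewrite <- Ny, Eyq, !formDl, !formDr, !formZl, !formZr, Np, Nq, (formC q p), F0. ring. }
  (* The image of l: orthogonal to A = H in the real case, the unit i of F in the complex case. *)
  pose (e := match c with RH => ol | CO => oi end).
  assert (HT : triple p q e).
  { destruct c; unfold e.
    - apply pu_RH in Hp, Pq. destruct Hp as [[p0 ->] P1], Pq as [[q0 ->] Q1].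
      repeat split; trivial; clear; oct.
    - pose proof Hp as Hp'. pose proof Pq as Pq'. apply pu_CO in Hp', Pq'. apply form_CO in Fq.
      destruct Hp' as (_ & P1 & Pi), Pq' as (_ & Q1 & Qi).
      repeat split; trivial; try (rewrite formC; assumption); try (clear; oct).
      transitivity (- formR (omul p oi) q); [|rewrite (proj2 Fq); ring].
      rewrite form_mull, (conjN p P1), mulNl, formNr. now rewrite formC. }
  destruct (ext_aut p q e HT) as [k Hk].
  assert (Ki : af k oi = p) by now rewrite Hk, ext_i.
  assert (Kj : af k oj = q) by now rewrite Hk, ext_j.
  assert (Kl : af k ol = e) by now rewrite Hk, ext_l.
  exists k. split; trivial.
  - exists a, b, (/ r), t. split; [|split]; trivial. rewrite <- Ey', Eyq, <- Ki, <- Kj, <- !af_scal, <- af_add.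
    f_equal. unfold vij. oct.
  - intros w [[w0 ->] W]. destruct c.
    + rewrite pu_RH. split.
      * rewrite Hk, ext_H. destruct w0 as [[? ?] [? ?]]. unfold dbl; cbn [fst snd].
        assert (A : forall r, inA RH (ofR r)) by (intros; apply inA_F, inF_R).
        destruct Hp as [Hp _], Pq as [Pq _].
        repeat (apply inA_add || apply inA_mul); trivial.
      * unfold one. rewrite <- (af_R k), af_form. exact W.
    + rewrite pu_CO. repeat split; trivial.
      * unfold one. rewrite <- (af_R k), af_form. exact W.
      * change oi with e. rewrite <- Kl, af_form. clear; oct.
  - intros w w' [[w0 ->] W] [[w1 ->] W'] E. destruct c.
    + now rewrite form_RH, af_form.
    + rewrite form_CO, af_form. split; trivial. change oi with e. rewrite <- Kl, <- af_mul, af_form. clear; oct.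
  - intros g Hg. unshelve eexists (exist _ (acomp k (acomp g (ainv k))) _).
    + intros s Hs. cbn. destruct c.
      * destruct Hs as [s' ->]. rewrite <- (af_R k) at 1. now rewrite afK, !af_R.
      * destruct Hs as [[s1 s2] ->].
        replace (ofC (s1, s2)) with (oadd (ofR s1) (omul (ofR s2) e)) by (unfold e; clear; oct).
        rewrite <- (af_R k s1), <- (af_R k s2), <- Kl, <- af_mul, <- af_add, afK, !af_add, !af_mul, Hg, !af_R. easy.
    + intros y'. unfold gf; cbn. now rewrite afK.
Qed.

(** * Coverings *)

Definition point_vector (c : FAcase) (p : Oct) : Prop := PuF c (inA c) p /\ p <> ozero.

Lemma mul_scal_r r u v : omul (scal r u) v = omul u (scal r v). Proof. oct. Qed.
Lemma inF_scal c r t : inF c t -> inF c (scal r t).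
Proof.
  destruct c; cbn.
  - intros [a ->]. exists (r * a). oct.
  - intros [[a b] ->]. exists (r * a, r * b). oct.
Qed.
Lemma pointset_scal c r p : r <> 0 -> pointset c (scal r p) = pointset c p.
Proof.
  intros Hr. apply functional_extensionality. intros y. apply propositional_extensionality.
  split; intros (t & Ht & ->).
  - exists (scal r t). split; [now apply inF_scal|apply mul_scal_r].
  - exists (scal (/ r) t). split; [now apply inF_scal|].
    rewrite mul_scal_r. transitivity (omul p (scal (r * / r) t)); [|f_equal; oct].
    rewrite Rinv_r by trivial. now rewrite scal1.
Qed.
Lemma form_mulF c y o t : inF c t -> form c y o = ozero -> form c (omul y t) o = ozero.
Proof.
  destruct c; rewrite ?form_RH, ?form_CO; cbn.
  - intros [a ->] H. transitivity (a * formR y o); [oct|rewrite H; ring].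
  - intros [[a b] ->] [H1 H2]. split.
    + transitivity (a * formR y o + b * formR (omul y oi) o); [oct|rewrite H1, H2; ring].
    + transitivity (a * formR (omul y oi) o - b * formR y o); [oct|rewrite H1, H2; ring].
Qed.
Lemma inF_conj c t : inF c t -> inF c (oconj t).
Proof.
  destruct c; cbn.
  - intros [a ->]. exists a. oct.
  - intros [[a b] ->]. exists (a, - b). oct.
Qed.
Lemma mul_conj_r x t : omul (omul x t) (oconj t) = scal (formR t t) x. Proof. oct. Qed.
Lemma scal_inv r x : r <> 0 -> scal (/ r) (scal r x) = x.
Proof. intros H. transitivity (scal (/ r * r) x); [oct|]. rewrite Rinv_l by trivial. apply scal1. Qed.
Lemma form_mulF_inv c x o r t : inF c t -> scal r (omul x t) <> ozero ->
  form c (scal r (omul x t)) o = ozero -> form c x o = ozero.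
Proof.
  intros Ht H0 H.
  assert (R0 : r <> 0) by (intros ->; apply H0, scal0).
  assert (T0 : formR t t <> 0).
  { intros E. apply H0. rewrite (form_eq0 t E). oct. }
  apply (form_scal_l c (/ r)) in H. rewrite scal_inv in H by trivial.
  apply (form_mulF c _ _ (oconj t)) in H; [|now apply inF_conj].
  rewrite mul_conj_r in H. apply (form_scal_l c (/ formR t t)) in H. now rewrite scal_inv in H.
Qed.
Lemma unit_nonzero x : formR x x = 1 -> x <> ozero.
Proof. intros H ->. rewrite form0r in H. lra. Qed.
Lemma onorm_nonzero x : x <> ozero -> onorm x <> 0.
Proof. intros H E. apply H, form_eq0. rewrite <- onorm_sqr, E. ring. Qed.
Lemma onorm_gf c (g : Gr c) x : onorm (gf g x) = onorm x.
Proof. unfold onorm. now rewrite gf_form. Qed.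

Definition mkpoint c p (H : point_vector c p) : Gpoint c :=
  exist _ (pointset c p) (ex_intro _ p (conj (proj1 H) (conj (proj2 H) eq_refl))).
Lemma line_proof c (g : Gr c) x : point_vector c x -> exists x' u, PuF c (inA c) x' /\ PuF c (fun _ => True) u /\
      onorm x' = onorm u /\ onorm x' <> 0 /\ lineset c x (gf g x) = lineset c x' u.
Proof.
  intros [H H0]. exists x, (gf g x). repeat split; trivial.
  - apply H.
  - apply H.
  - apply (PuO_gf c g x), PuA_O, H.
  - now rewrite onorm_gf.
  - now apply onorm_nonzero.
Qed.
Definition mkline c (g : Gr c) x (H : point_vector c x) : Gline c := exist _ (lineset c x (gf g x)) (line_proof c g x H).

Section Covering.
Variables (c : FAcase) (G' : geometry) (f : elt G' -> elt (Gamma c)).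
Hypothesis Hgeo : is_geometry G'.
Hypothesis Hconn : Defs.connected G'.
Hypothesis Hcov : Defs.covering G' (Gamma c) f.

Lemma inc_refl a : inc G' a a. Proof. destruct Hgeo as (H & _). apply H. Qed.
Lemma inc_sym a b : inc G' a b -> inc G' b a. Proof. destruct Hgeo as (_ & H & _). apply H. Qed.
Lemma f_typ a : typ G' a = Gtyp c (f a). Proof. destruct Hcov as ([H _] & _). symmetry. apply H. Qed.
Lemma inc_eq a b : inc G' a b -> Gtyp c (f a) = Gtyp c (f b) -> a = b.
Proof. intros H E. destruct Hgeo as (_ & _ & He). apply He; trivial. now rewrite !f_typ. Qed.

Lemma lift a d : Ginc c (f a) d -> Gtyp c d <> Gtyp c (f a) -> exists b, inc G' a b /\ f b = d.
Proof.
  intros H T. destruct Hcov as (_ & _ & Hl). destruct (Hl a) as (_ & H2 & _).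
  destruct (H2 d) as (b & [Hb _] & E); [now split|]. now exists b.
Qed.
Lemma lift_inj a b b' : inc G' a b -> inc G' a b' -> f b = f b' -> Gtyp c (f b) <> Gtyp c (f a) -> b = b'.
Proof.
  intros H H' E T. destruct Hcov as (_ & _ & Hl). destruct (Hl a) as (H1 & _ & _).
  apply H1; trivial; split; trivial; rewrite !f_typ; trivial. now rewrite <- E.
Qed.
Lemma lift_inc a b b' : inc G' a b -> inc G' a b' -> Gtyp c (f b) <> Gtyp c (f a) ->
  Gtyp c (f b') <> Gtyp c (f a) -> Ginc c (f b) (f b') -> inc G' b b'.
Proof.
  intros H H' T T' E. destruct Hcov as (_ & _ & Hl). destruct (Hl a) as (_ & _ & H3).
  apply H3; trivial; split; trivial; now rewrite !f_typ.
Qed.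

(** * Lifted planes sharing a lifted point *)

Definition over_point (p : Oct) (a : elt G') : Prop := exists P : Gpoint c, f a = inl P /\ proj1_sig P = pointset c p.
Definition over_plane (g : Gr c) (a : elt G') : Prop := f a = inr (inr (plane g)).
(** For fixed p this is an equivalence relation on lifted planes, each class containing exactly one
    lift of every plane. *)
Definition share (p : Oct) (a b : elt G') : Prop := exists p', over_point p p' /\ inc G' p' a /\ inc G' p' b.

Lemma over_point_eq p a b : over_point p a -> over_point p b -> f a = f b.
Proof.
  intros (P & E & EP) (Q & F & EQ). rewrite E, F. f_equal. apply sig_eq. now rewrite EP, EQ.
Qed.

Lemma share_point_unique p g a p1 p2 : over_plane g a -> over_point p p1 -> over_point p p2 ->
  inc G' p1 a -> inc G' p2 a -> p1 = p2.
Proof.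
  intros Ha H1 H2 I1 I2. apply (lift_inj a); try now apply inc_sym.
  - now apply (over_point_eq p).
  - destruct H1 as (P & E & _). rewrite E, Ha. discriminate.
Qed.
Lemma share_exists p g h a : point_vector c p -> over_plane g a -> exists b, over_plane h b /\ share p a b.
Proof.
  intros Hp Ha.
  destruct (lift a (inl (mkpoint c p Hp))) as (p' & Ip & E).
  - right; right. rewrite Ha. exact I.
  - rewrite Ha. discriminate.
  - destruct (lift p' (inr (inr (plane h)))) as (b & Ib & Eb).
    + right; left. rewrite E. exact I.
    + rewrite E. discriminate.
    + exists b. split; trivial. exists p'. split; [|split; trivial; now apply inc_sym].
      now exists (mkpoint c p Hp).
Qed.
Lemma share_unique p g h a b b' : over_plane g a -> over_plane h b -> over_plane h b' ->
  share p a b -> share p a b' -> b = b'.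
Proof.
  intros Ha Hb Hb' (p1 & P1 & I1 & J1) (p2 & P2 & I2 & J2).
  assert (p1 = p2) as <- by now apply (share_point_unique p g a).
  apply (lift_inj p1); trivial.
  - now rewrite Hb, Hb'.
  - destruct P1 as (P & E & _). rewrite E, Hb. discriminate.
Qed.
Lemma share_trans p g a b d : over_plane g b -> share p a b -> share p b d -> share p a d.
Proof.
  intros Hb (p1 & P1 & I1 & J1) (p2 & P2 & I2 & J2).
  assert (p1 = p2) as <- by now apply (share_point_unique p g b).
  now exists p1.
Qed.
Lemma share_refl p g a : point_vector c p -> over_plane g a -> share p a a.
Proof.
  intros Hp Ha. destruct (share_exists p g g a Hp Ha) as (b & _ & p1 & P1 & I1 & _). now exists p1.
Qed.

(** The line [x, gx] lies in both planes and contains p and q. Its lift in the residue of a passes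
    through p', hence lies in b, and its residue contains a common lift of q. *)
Lemma share_line p q x g h a b : point_vector c p -> point_vector c q -> point_vector c x ->
  form c x p = ozero -> form c x q = ozero -> over_plane g a -> over_plane h b ->
  gf g x = gf h x -> share p a b -> share q a b.
Proof.
  intros Hp Hq Hx Fp Fq Ha Hb E (p' & (P & EP & EP') & I1 & I2).
  set (L := mkline c g x Hx).
  assert (La : Ginc c (inr (inl L)) (f a)).
  { right; left. rewrite Ha. exists x, (gf g x). split; trivial. cbn. apply planefunE, Hx. }
  assert (Lb : Ginc c (inr (inl L)) (f b)).
  { right; left. rewrite Hb. exists x, (gf g x). split; trivial. cbn. rewrite E. apply planefunE, Hx. }
  assert (Lp : Ginc c (f p') (inr (inl L))).
  { right; left. rewrite EP. exists p, x, (gf g x). now repeat split. }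
  destruct (lift a (inr (inl L))) as (l & Il & El).
  { destruct La as [La|[La|La]]; [left|right; right|right; left]; easy. }
  { rewrite Ha. discriminate. }
  assert (Ipl : inc G' p' l).
  { apply (lift_inc a); trivial; [now apply inc_sym|..]; rewrite ?EP, ?Ha, ?El; try discriminate.
    now rewrite <- EP. }
  assert (Ilb : inc G' l b).
  { apply (lift_inc p'); trivial; rewrite ?EP, ?Hb, ?El; try discriminate. now rewrite <- Hb. }
  destruct (lift l (inl (mkpoint c q Hq))) as (q' & Iq & Eq).
  { rewrite El. right; right. exists q, x, (gf g x). now repeat split. }
  { rewrite El. discriminate. }
  exists q'. split; [now exists (mkpoint c q Hq)|].
  split; apply (lift_inc l); trivial; rewrite ?El, ?Eq, ?Ha, ?Hb; try discriminate;
    try (right; left; exact I); now apply inc_sym.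
Qed.

(** The automorphism is recorded because in the real case its restriction to H does not determine
    it. *)
Definition state : Type := { st : elt G' * Gr c | over_plane (snd st) (fst st) }.
Definition st_plane (xi : state) : elt G' := fst (proj1_sig xi).
Definition st_gr (xi : state) : Gr c := snd (proj1_sig xi).
Lemma st_over xi : over_plane (st_gr xi) (st_plane xi). Proof. exact (proj2_sig xi). Qed.
Lemma state_eq xi eta : st_plane xi = st_plane eta -> st_gr xi = st_gr eta -> xi = eta.
Proof.
  intros H1 H2. apply sig_eq. unfold st_plane, st_gr in *.
  destruct (proj1_sig xi), (proj1_sig eta); cbn in *. now subst.
Qed.

(* Left action on pairs (lifted plane, automorphism inducing its image). *)
Definition moved (p : Oct) (k : Gr c) (xi eta : state) : Prop :=
  st_gr eta = gmul (st_gr xi) (ginv k) /\ share p (st_plane xi) (st_plane eta).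
Definition move (p : Oct) (k : Gr c) (xi : state) : state := epsilon (inhabits xi) (moved p k xi).

Lemma moved_move p k xi : point_vector c p -> moved p k xi (move p k xi).
Proof.
  intros Hp. unfold move. apply epsilon_spec.
  destruct (share_exists p (st_gr xi) (gmul (st_gr xi) (ginv k)) (st_plane xi) Hp (st_over xi)) as (b & Hb & Sb).
  exists (exist _ (b, gmul (st_gr xi) (ginv k)) Hb). now split.
Qed.
Lemma move_unique p k xi eta : point_vector c p -> moved p k xi eta -> move p k xi = eta.
Proof.
  intros Hp [H1 H2]. destruct (moved_move p k xi Hp) as [H3 H4]. apply state_eq.
  - apply (share_unique p (st_gr xi) (gmul (st_gr xi) (ginv k)) (st_plane xi)); trivial.
    + apply st_over.
    + rewrite <- H3. apply st_over.
    + rewrite <- H1. apply st_over.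
  - now rewrite H1, H3.
Qed.
Lemma move_mul p g h xi : point_vector c p -> move p (gmul g h) xi = move p g (move p h xi).
Proof.
  intros Hp. apply move_unique; trivial.
  destruct (moved_move p h xi Hp) as [H1 H2]. destruct (moved_move p g (move p h xi) Hp) as [H3 H4].
  split.
  - rewrite H3, H1. apply gf_inj. easy.
  - apply (share_trans p (st_gr (move p h xi)) _ (st_plane (move p h xi))); trivial. apply st_over.
Qed.
Lemma move_id p g xi : point_vector c p -> (forall x, gf g x = x) -> move p g xi = xi.
Proof.
  intros Hp Hg. apply move_unique; trivial. split.
  - apply gf_inj. intros x. rewrite gf_mul. f_equal. rewrite <- (Hg x) at 2. now rewrite gf_invl.
  - apply (share_refl p (st_gr xi)); trivial. apply st_over.
Qed.
(** As k fixes x, the automorphisms before and after the move agree at x, so [share_line]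
    applies. *)
Lemma move_line p q x k xi : point_vector c p -> point_vector c q -> point_vector c x -> form c x p = ozero -> form c x q = ozero ->
  gf k x = x -> move p k xi = move q k xi.
Proof.
  intros Hp Hq Hx Fp Fq Hk. apply move_unique; trivial.
  destruct (moved_move q k xi Hq) as [H1 H2]. split; trivial.
  apply (share_line q p x (st_gr xi) (st_gr (move q k xi))); trivial; try apply st_over.
  rewrite H1, gf_mul. f_equal. rewrite <- Hk at 2. now rewrite gf_invl.
Qed.

Lemma share_pointset p q a b : pointset c p = pointset c q -> share p a b -> share q a b.
Proof.
  intros E (p' & (P & H1 & H2) & I). exists p'. split; trivial. exists P. now rewrite <- E.
Qed.

(** The abstract core in a real frame: p is the image of i, o is the image of k, and x is an
    F-multiple of the image of ai + bj. *)
Lemma move_unit p x : point_vector c p -> formR p p = 1 -> point_vector c x ->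
  exists o, point_vector c o /\ form c x o = ozero /\ forall k xi, gf k x = x -> move o k xi = move p k xi.
Proof.
  intros [Hp _] Np [Hx X0].
  destruct (real_frame_exists c p x Hp Np Hx X0) as (kap & [Ri (a & b & r & t & Hab & Ht & Ex) Rp Rf Rx]).
  assert (V : forall w, imu w -> point_vector c (af kap w)).
  { intros w [W1 W2]. split; [now apply Rp|]. apply unit_nonzero. now rewrite af_form. }
  assert (Fx : form c x (af kap ok) = ozero).
  { apply (form_mulF_inv c x _ r t Ht); rewrite <- Ex.
    - apply (V (vij a b)). now apply imu_vij.
    - apply Rf; [now apply imu_vij|apply imu_k|]. unfold vij. oct. }
  exists (af kap ok). split; [apply V, imu_k|]. split; trivial.
  intros k xi Hk. rewrite <- Ri.
  refine (vij_stabilizer (Gr c) state gmul ginv (fun g y => ab kap (gf g (af kap y)))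
    (fun w => move (af kap w)) _ _ _ _ _ _ _ _ _ _ a b k xi Hab _).
  - intros g h E. apply gf_inj. intros y. rewrite <- (abK kap y).
    rewrite <- (abK kap (gf g _)), E, abK. easy.
  - intros g h y. now rewrite abK, gf_mul.
  - intros g y. now rewrite abK, gf_invl, afK.
  - intros g y. now rewrite abK, gf_invr, afK.
  - intros g y. rewrite af_neg. unfold gf. rewrite af_neg. apply (af_neg (ainv kap)).
  - intros w g h eta Hw. apply move_mul. auto.
  - intros w g eta Hw E. apply move_id; auto. intros y. 
    rewrite <- (abK kap (gf g y)), <- (abK kap y) at 1. now rewrite E, abK.
  - intros w w' y g eta Hw Hw' Hy F F' E. apply (move_line _ _ (af kap y)); auto.
    + apply Rf; try apply Hw; try apply Hy. now rewrite formC.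
    + apply Rf; try apply Hw'; try apply Hy. now rewrite formC.
    + rewrite <- E at 2. now rewrite abK.
  - intros q0 q1 q2 q3 U. destruct (rot_aut q0 q1 q2 q3 U) as (g & Gl & Gx).
    destruct (Rx g Gl) as [g' Hg']. exists g'. intros y. now rewrite Hg', afK, Gx.
  - destruct twist_aut as (g & Gl & Gx). destruct (Rx g Gl) as [g' Hg']. exists g'.
    intros y. now rewrite Hg', afK, Gx.
  (* [k] fixes x, hence also its F-multiple representing ai + bj. *)
  - cbv beta. rewrite Ex, gf_scal, gf_mulo, Hk, gf_F, <- Ex by trivial. apply afK.
Qed.

(** After rescaling, p and q are replaced by points orthogonal to x, which [move_line] compares. *)
Lemma move_point_indep x p q k xi : point_vector c x -> gf k x = x -> point_vector c p -> point_vector c q -> move p k xi = move q k xi.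
Proof.
  intros Hx Hk.
  assert (H : forall p, point_vector c p -> exists o, point_vector c o /\ form c x o = ozero /\ move o k xi = move p k xi).
  { clear p q. intros p [Hp P0]. destruct (normalize c p (PuA_O _ _ Hp) P0) as (r & p0 & Hr & Ep & _ & Np & Pp0).
    destruct (move_unit p0 x) as (o & Ho & Fo & E); trivial.
    { split; auto. now apply unit_nonzero. }
    exists o. split; trivial. split; trivial. rewrite E by trivial.
    assert (Es : pointset c p = pointset c p0) by (rewrite Ep; apply pointset_scal; lra).
    symmetry. apply move_unique; [now split|].
    destruct (moved_move p0 k xi) as [M1 M2]; [split; auto; now apply unit_nonzero|].
    split; trivial. now apply (share_pointset p0). }
  intros Hp Hq. destruct (H p Hp) as (o & Ho & Fo & <-). destruct (H q Hq) as (o' & Ho' & Fo' & <-).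
  now apply (move_line o o' x).
Qed.

Lemma point_vector_e : point_vector c (e1 c) /\ point_vector c (e2 c).
Proof.
  destruct (PuA_e c) as (P1 & P2 & _). destruct (norm_e c) as (N1 & N2 & _).
  repeat split; trivial; try apply P1; try apply P2; now apply unit_nonzero.
Qed.

Lemma move_indep p q k xi : point_vector c p -> point_vector c q -> move p k xi = move q k xi.
Proof.
  intros Hp Hq. destruct point_vector_e as [V1 V2].
  destruct (stabilizers_generate c k) as (k1 & k2 & k3 & -> & H1 & H2 & H3).
  rewrite !move_mul by trivial.
  rewrite (move_point_indep (e2 c) p q k3), (move_point_indep (e1 c) p q k2), (move_point_indep (e2 c) p q k1); trivial.
Qed.

(** * Injectivity of the covering *)

Lemma plane_over a : typ G' a = TPl -> exists g, over_plane g a.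
Proof.
  rewrite f_typ. unfold over_plane. destruct (f a) as [P|[L|Phi]]; try discriminate.
  intros _. destruct (plane_surj c Phi) as [g ->]. now exists g.
Qed.

(** If a and b induce g and h, the move by h⁻¹g takes (a, g) to (b, h) at p, hence also at q. *)
Lemma share_indep p q a b : point_vector c p -> point_vector c q -> typ G' a = TPl -> typ G' b = TPl -> share p a b -> share q a b.
Proof.
  intros Hp Hq Ta Tb H. destruct (plane_over a Ta) as [g Hg], (plane_over b Tb) as [h Hh].
  set (xi := exist (fun st => over_plane (snd st) (fst st)) (a, g) Hg : state).
  set (eta := exist (fun st => over_plane (snd st) (fst st)) (b, h) Hh : state).
  pose (k := gmul (ginv h) g).
  assert (M : move p k xi = eta).
  { apply move_unique; trivial. split; trivial. apply gf_inj. intros x. 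
    unfold k, gf; cbn. now rewrite abK. }
  rewrite (move_indep p q) in M by trivial.
  destruct (moved_move q k xi Hq) as [_ S]. now rewrite M in S.
Qed.

Lemma plane_incident a : exists g, Ginc c (f a) (inr (inr (plane g))).
Proof.
  destruct (f a) as [P|[L|Phi]].
  - exists gone. right; left. exact I.
  - destruct L as [L (x & u & Hx & Hu & E & N & EL)].
    destruct (line_in_plane c x u Hx Hu E N) as [g Hg]. exists g. right; left.
    exists x, u. split; trivial. cbn. rewrite planefunE; trivial. apply Hx.
  - destruct (plane_surj c Phi) as [g ->]. exists g. now left.
Qed.

Lemma lift_plane a g : Ginc c (f a) (inr (inr (plane g))) -> exists b, inc G' a b /\ over_plane g b.
Proof.
  intros H. destruct (classic (Gtyp c (f a) = TPl)) as [T|T].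
  - exists a. split; [apply inc_refl|]. unfold over_plane. 
    destruct H as [H|[H|H]]; trivial; destruct (f a) as [P|[L|Phi]]; try discriminate; destruct H.
  - apply lift; trivial. intros E. apply T. now rewrite <- E.
Qed.

(** Common planes let sharing be carried along a path. If one element is a point, any plane on the
    other will do, since every point lies on every plane. *)
Lemma flag_plane a b : inc G' a b -> exists d, typ G' d = TPl /\ inc G' a d /\ inc G' b d.
Proof.
  intros H.
  assert (HH : forall a b, inc G' a b -> Gtyp c (f a) = TP -> exists d, typ G' d = TPl /\ inc G' a d /\ inc G' b d).
  { clear a b H. intros a b H T.
    destruct (plane_incident b) as [g Hg]. destruct (lift_plane b g Hg) as (d & Id & Hd).
    assert (Td : typ G' d = TPl) by now rewrite f_typ, Hd.
    exists d. split; trivial. split; trivial.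
    destruct (classic (Gtyp c (f b) = TP)) as [Tb|Tb].
    { now rewrite (inc_eq a b H) by congruence. }
    destruct (classic (Gtyp c (f b) = TPl)) as [Tb'|Tb'].
    { now rewrite <- (inc_eq b d Id) by (rewrite <- (f_typ d); congruence). }
    apply (lift_inc b); trivial; [now apply inc_sym|congruence| |].
    - rewrite <- (f_typ d). congruence.
    - rewrite Hd. destruct (f a) as [P|[L|Phi]]; try discriminate. right; left. exact I. }
  destruct (Gtyp c (f a)) eqn:Ta.
  - now apply HH.
  - destruct (Gtyp c (f b)) eqn:Tb.
    + destruct (HH b a) as (d & D1 & D2 & D3); trivial; [now apply inc_sym|]. now exists d.
    + rewrite (inc_eq a b H) by congruence.
      destruct (plane_incident b) as [g Hg]. destruct (lift_plane b g Hg) as (d & Id & Hd).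
      exists d. split; [now rewrite f_typ, Hd|easy].
    + exists b. split; [now rewrite f_typ|]. split; trivial. apply inc_refl.
  - exists a. split; [now rewrite f_typ|]. split; [apply inc_refl|now apply inc_sym].
Qed.

(** A common point is shared by definition, a common line supplies a lifted point orthogonal to x,
    and a common plane forces d = d'. [share_indep] then passes to p. *)
Lemma share_of_inc a d d' p : point_vector c p -> typ G' d = TPl -> typ G' d' = TPl ->
  inc G' a d -> inc G' a d' -> share p d d'.
Proof.
  intros Hp Td Td' I1 I2. destruct (plane_over d Td) as [g Hg].
  destruct (f a) as [P|[L|Phi]] eqn:Ea.
  - destruct (proj2_sig P) as (q & Q1 & Q2 & Q3).
    apply (share_indep q p); trivial; [now split|]. exists a. split; [now exists P|easy].
  - destruct (proj2_sig L) as (x & u & Hx & Hu & E & N & EL).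
    assert (X0 : x <> ozero) by (intros ->; apply N; unfold onorm; rewrite form0r; apply sqrt_0).
    destruct (normalize c x (PuA_O _ _ Hx) X0) as (r & x0 & Hr & Ex & _ & Nx & Px).
    destruct (exists_orth_PuA c x0 (Px Hx) Nx) as (q & Q1 & Q2 & Q3).
    assert (Vq : point_vector c q) by (split; trivial; now apply unit_nonzero).
    apply (share_indep q p); trivial.
    destruct (lift a (inl (mkpoint c q Vq))) as (q' & J & Eq).
    { rewrite Ea. right; right. exists q, x, u. repeat split; trivial. rewrite Ex. now apply form_scal_l. }
    { rewrite Ea. discriminate. }
    exists q'. split; [now exists (mkpoint c q Vq)|].
    destruct (plane_over d' Td') as [g' Hg'].
    split; apply (lift_inc a); trivial; rewrite ?Ea, ?Eq, ?Hg, ?Hg'; try discriminate; right; left; exact I.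
  - rewrite <- (inc_eq a d I1), <- (inc_eq a d' I2).
    + apply (share_refl p g); trivial. now rewrite (inc_eq a d I1) by (rewrite Hg, Ea; easy).
    + rewrite Ea, <- (f_typ d'). now rewrite Td'.
    + rewrite Ea, Hg. easy.
Qed.

(** Induction along a path from a to b, through a common plane of each incident pair. *)
Lemma share_all p a b d d' : point_vector c p -> typ G' d = TPl -> typ G' d' = TPl ->
  inc G' a d -> inc G' b d' -> share p d d'.
Proof.
  intros Hp Td Td' Id. revert d' Td'. generalize (Hconn a b). intros R.
  apply clos_rt_rtn1 in R. induction R as [|b e H R IH]; intros d' Td' Id'.
  - now apply (share_of_inc a).
  - destruct (flag_plane b e H) as (k & Tk & K1 & K2).
    destruct (plane_over k Tk) as [g Hg].
    apply (share_trans p g d k d'); trivial; [now apply IH|]. now apply (share_of_inc e).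
Qed.

(** Lifts of one plane on a and on b share a point, hence coincide; a and b then lie in the same
    residue, where the covering is injective. *)
Lemma covering_injective a b : f a = f b -> a = b.
Proof.
  intros E. destruct point_vector_e as [V _].
  destruct (plane_incident a) as [g Hg].
  destruct (lift_plane a g Hg) as (d & Id & Hd).
  rewrite E in Hg. destruct (lift_plane b g Hg) as (d' & Id' & Hd').
  assert (Td : typ G' d = TPl) by now rewrite f_typ, Hd.
  assert (Td' : typ G' d' = TPl) by now rewrite f_typ, Hd'.
  assert (d = d') as <-.
  { apply (share_unique (e1 c) g g d); trivial.
    - now apply (share_refl _ g).
    - now apply (share_all _ a b). }
  destruct (classic (Gtyp c (f a) = TPl)) as [T|T].
  - assert (Td0 : Gtyp c (f d) = TPl) by now rewrite <- f_typ.
    transitivity d; [|symmetry]; apply inc_eq; trivial; congruence.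
  - apply (lift_inj d); trivial; try now apply inc_sym. now rewrite Hd.
Qed.
End Covering.

Theorem mainTheorem14 (c : FAcase) :
  simply_connected (Gamma c) \/ covered_by_building (Gamma c).
Proof.
  left. intros G' f Hgeo Hconn Hcov. now apply covering_injective.
Qed.
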